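(* Let $\alpha>0$ and let $\theta\in\mathbb{H}$ with $|\theta|<1$. Then the integral transform $\mathcal{L}_\theta^\alpha$ maps $L^{2,\alpha}_{\mathbb{H}}(\mathbb{R}^+)$ continuously into itself and is a $k$-contraction for some $k\le (1-|\theta|^2)^{-1/2}$, i.e. $\|\mathcal{L}_\theta^\alpha\varphi\|_\alpha\le k\,\|\varphi\|_\alpha$ for all $\varphi\in L^{2,\alpha}_{\mathbb{H}}(\mathbb{R}^+)$, with $k\le (1-|\theta|^2)^{-1/2}$.
   Context: $\mathbb{H}$ denotes the quaternions and $\mathbb{R}^+=(0,\infty)$. For $\alpha>0$, $L^{2,\alpha}_{\mathbb{H}}(\mathbb{R}^+)$ is the right quaternionic Hilbert space of (classes of) functions $\varphi:\mathbb{R}^+\to\mathbb{H}$ that are square integrable with respect to the inner product $\langle\varphi,\psi\rangle_\alpha=\int_0^\infty\overline{\varphi(x)}\,\psi(x)\,x^\alpha e^{-x}\,dx$; $\|\cdot\|_\alpha$ is the associated norm. The generalized Laguerre polynomials are $L_n^{(\alpha)}(x)=\frac{x^{-\alpha}e^x}{n!}\frac{d^n}{dx^n}\left(x^{n+\alpha}e^{-x}\right)$. For $\theta\in\mathbb{H}$ with $|\theta|<1$ and $x,y>0$ put $$R_\theta^\alpha(x,y)=\sum_{n=0}^\infty\frac{n!}{\Gamma(\alpha+n+1)}\,\theta^n L_n^{(\alpha)}(x)L_n^{(\alpha)}(y),\qquad K_\theta^\alpha(x,y)=x^\alpha e^{-x}R_\theta^\alpha(x,y).$$ The transform is $$\mathcal{L}_\theta^\alpha(\varphi)(y)=\int_0^\infty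 K_\theta^\alpha(x,y)\,\varphi(x)\,dx .$$ *)

(* Defs.v *)
From HB Require Import structures.
From mathcomp Require Import all_boot all_order all_algebra.
From mathcomp Require Import ring lra.
From mathcomp Require Import all_classical all_reals all_analysis.

Set Implicit Arguments.
Unset Strict Implicit.
Unset Printing Implicit Defensive.

Import Order.TTheory GRing.Theory Num.Theory.
Import numFieldNormedType.Exports.

Local Open Scope classical_set_scope.
Local Open Scope ring_scope.

(** * Quaternions *)

Record quaternion (R : realType) := Quat { qre : R; qi : R; qj : R; qk : R }.

Section Quaternion.
Variable R : realType.
Local Notation H := (quaternion R).
Implicit Types (p q r : H) (a b : R).

Lemma quatP p q :
  qre p = qre q -> qi p = qi q -> qj p = qj q -> qk p = qk q -> p = q.
Proof. by case: p q => [? ? ? ?] [? ? ? ?] /= -> -> -> ->. Qed.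

Let to_tuple q := (qre q, qi q, qj q, qk q).
Let of_tuple (t : R * R * R * R) := let: (a, b, c, d) := t in @Quat R a b c d.
Let to_tupleK : cancel to_tuple of_tuple. Proof. by case. Qed.

HB.instance Definition _ := Choice.copy H (can_type to_tupleK).

Definition addq p q :=
  Quat (qre p + qre q) (qi p + qi q) (qj p + qj q) (qk p + qk q).
Definition oppq q := Quat (- qre q) (- qi q) (- qj q) (- qk q).
Definition zeroq : H := Quat 0 0 0 0.

Let addqA : associative addq.
Proof. by move=> p q r; apply: quatP => /=; rewrite addrA. Qed.
Let addqC : commutative addq.
Proof. by move=> p q; apply: quatP => /=; rewrite addrC. Qed.
Let add0q : left_id zeroq addq.
Proof. by move=> p; apply: quatP => /=; rewrite add0r. Qed.
Let addNq : left_inverse zeroq oppq addq.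
Proof. by move=> p; apply: quatP => /=; rewrite addNr. Qed.

HB.instance Definition _ := GRing.isZmodule.Build H addqA addqC add0q addNq.

Definition oneq : H := Quat 1 0 0 0.
Definition mulq p q :=
  Quat (qre p * qre q - qi p * qi q - qj p * qj q - qk p * qk q)
       (qre p * qi q + qi p * qre q + qj p * qk q - qk p * qj q)
       (qre p * qj q - qi p * qk q + qj p * qre q + qk p * qi q)
       (qre p * qk q + qi p * qj q - qj p * qi q + qk p * qre q).

Let mulqA : associative mulq.
Proof. by move=> p q r; apply: quatP => /=; ring. Qed.
Let mul1q : left_id oneq mulq.
Proof. by move=> p; apply: quatP => /=; ring. Qed.
Let mulq1 : right_id oneq mulq.
Proof. by move=> p; apply: quatP => /=; ring. Qed.
Let mulqDl : left_distributive mulq +%R.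
Proof. by move=> p q r; apply: quatP => /=; ring. Qed.
Let mulqDr : right_distributive mulq +%R.
Proof. by move=> p q r; apply: quatP => /=; ring. Qed.
Let oneq_neq0 : oneq != 0.
Proof. by apply/eqP => -[] /eqP; rewrite oner_eq0. Qed.

HB.instance Definition _ :=
  GRing.Zmodule_isNzRing.Build H mulqA mul1q mulq1 mulqDl mulqDr oneq_neq0.

Definition scaleq a q := Quat (a * qre q) (a * qi q) (a * qj q) (a * qk q).

Let scaleqA a b q : scaleq a (scaleq b q) = scaleq (a * b) q.
Proof. by apply: quatP => /=; rewrite mulrA. Qed.
Let scale1q : left_id 1 scaleq.
Proof. by move=> q; apply: quatP => /=; rewrite mul1r. Qed.
Let scaleqDr : right_distributive scaleq +%R.
Proof. by move=> a p q; apply: quatP => /=; rewrite mulrDr. Qed.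
Let scaleqDl q : {morph scaleq^~ q : a b / a + b}.
Proof. by move=> a b; apply: quatP => /=; rewrite mulrDl. Qed.

HB.instance Definition _ :=
  GRing.Zmodule_isLmodule.Build R H scaleqA scale1q scaleqDr scaleqDl.

Let scaleqAl a p q : a *: (p * q) = (a *: p) * q.
Proof. by apply: quatP => /=; ring. Qed.
HB.instance Definition _ := GRing.Lmodule_isLalgebra.Build R H scaleqAl.

Let scaleqAr a p q : a *: (p * q) = p * (a *: q).
Proof. by apply: quatP => /=; ring. Qed.
HB.instance Definition _ := GRing.Lalgebra_isAlgebra.Build R H scaleqAr.

Definition conjq q := Quat (qre q) (- qi q) (- qj q) (- qk q).

Definition normq q : R :=
  Num.sqrt (qre q ^+ 2 + qi q ^+ 2 + qj q ^+ 2 + qk q ^+ 2).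

Let normq_ge0 q : 0 <= normq q. Proof. exact: sqrtr_ge0. Qed.

Let sum4_ge0 q : 0 <= qre q ^+ 2 + qi q ^+ 2 + qj q ^+ 2 + qk q ^+ 2.
Proof. by rewrite !addr_ge0// sqr_ge0. Qed.

Let ler_normqD p q : normq (p + q) <= normq p + normq q.
Proof.
rewrite -(@ler_pXn2r _ 2) ?nnegrE ?addr_ge0//.
rewrite sqrrD /normq !sqr_sqrtr//.
set S := qre p * qre q + qi p * qi q + qj p * qj q + qk p * qk q.
have CS : S <= normq p * normq q.
  apply: (le_trans (ler_norm _)).
  rewrite -(@ler_pXn2r _ 2) ?nnegrE ?mulr_ge0//.
  rewrite real_normK ?num_real// exprMn /normq !sqr_sqrtr// /S -subr_ge0.
  set D := (X in 0 <= X).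
  have -> : D =
    (qre p * qi q - qi p * qre q) ^+ 2 + (qre p * qj q - qj p * qre q) ^+ 2 +
    (qre p * qk q - qk p * qre q) ^+ 2 + (qi p * qj q - qj p * qi q) ^+ 2 +
    (qi p * qk q - qk p * qi q) ^+ 2 + (qj p * qk q - qk p * qj q) ^+ 2.
    by rewrite /D; ring.
  by rewrite !addr_ge0// sqr_ge0.
rewrite -/(normq p) -/(normq q) /=.
rewrite [leLHS](_ : _ =
  qre p ^+ 2 + qi p ^+ 2 + qj p ^+ 2 + qk p ^+ 2 + S *+ 2 +
  (qre q ^+ 2 + qi q ^+ 2 + qj q ^+ 2 + qk q ^+ 2)); last by rewrite /S; ring.
by rewrite lerD2r lerD2l lerMn2r.
Qed.

Let normqZ a q : normq (a *: q) = `|a| * normq q.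
Proof.
rewrite /normq -sqrtr_sqr -sqrtrM ?sqr_ge0//.
by congr Num.sqrt => /=; ring.
Qed.

Let normq0_eq0 q : normq q = 0 -> q = 0.
Proof.
move=> /eqP; rewrite sqrtr_eq0 => le0.
have /eqP := le_anti (introT andP (conj le0 (sum4_ge0 q))).
rewrite !paddr_eq0 ?addr_ge0 ?sqr_ge0// !sqrf_eq0.
by move=> /andP[/andP[/andP[/eqP ? /eqP ?] /eqP ?] /eqP ?]; apply: quatP.
Qed.

HB.instance Definition _ :=
  Lmodule_isNormed.Build R H ler_normqD normqZ normq0_eq0.

Lemma normqE q :
  `|q| = Num.sqrt (qre q ^+ 2 + qi q ^+ 2 + qj q ^+ 2 + qk q ^+ 2).
Proof. by []. Qed.

End Quaternion.

Section QuaternionIntegral.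
Context {R : realType}.
Local Notation mu := (@lebesgue_measure R).

Definition qmeasurable (D : set R) (f : R -> quaternion R) :=
  [/\ measurable_fun D (fun x => qre (f x)),
      measurable_fun D (fun x => qi (f x)),
      measurable_fun D (fun x => qj (f x)) &
      measurable_fun D (fun x => qk (f x))].

Definition qintegrable (D : set R) (f : R -> quaternion R) :=
  [/\ mu.-integrable D (fun x => (qre (f x))%:E),
      mu.-integrable D (fun x => (qi (f x))%:E),
      mu.-integrable D (fun x => (qj (f x))%:E) &
      mu.-integrable D (fun x => (qk (f x))%:E)].

Definition qintegral (D : set R) (f : R -> quaternion R) : quaternion R :=
  Quat (\int[mu]_(x in D) qre (f x)) (\int[mu]_(x in D) qi (f x))
       (\int[mu]_(x in D) qj (f x)) (\int[mu]_(x in D) qk (f x)).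

End QuaternionIntegral.

Section Laguerre.
Context {R : realType}.
Local Notation mu := (@lebesgue_measure R).
Local Notation H := (quaternion R).

Definition Rplus : set R := `]0, +oo[.

(** The elements of L^{2,alpha}_H are represented by functions R -> H of which
    only the restriction to (0, +oo) matters, identified up to
    a.e. equality on (0, +oo). *)

Definition laguerre_weight (alpha x : R) : R := x `^ alpha * expR (- x).

Definition L2 (alpha : R) (phi : R -> H) : Prop :=
  qmeasurable Rplus phi /\
  (\int[mu]_(x in Rplus) (`|phi x| ^+ 2 * laguerre_weight alpha x)%:E < +oo)%E.

Definition L2inner (alpha : R) (phi psi : R -> H) : H :=
  qintegral Rplus
    (fun x => laguerre_weight alpha x *: (conjq (phi x) * psi x)).

(* The quaternion <phi, phi> is real and nonnegative. *)
Definition L2norm (alpha : R) (phi : R -> H) : R :=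
  Num.sqrt (qre (L2inner alpha phi phi)).

Definition Gamma (s : R) : R :=
  \int[mu]_(t in Rplus) (t `^ (s - 1) * expR (- t)).

(* Rodrigues' formula, meaningful for x > 0. *)
Definition laguerre (alpha : R) (n : nat) (x : R) : R :=
  x `^ (- alpha) * expR x / n`!%:R *
  derive1n n (fun t : R => t `^ (n%:R + alpha) * expR (- t)) x.

Definition laguerre_term (alpha : R) (theta : H) (x y : R) (n : nat) : H :=
  (n`!%:R / Gamma (alpha + n%:R + 1)
    * laguerre alpha n x * laguerre alpha n y) *: theta ^+ n.

Definition laguerre_R (alpha : R) (theta : H) (x y : R) : H :=
  limn (series (laguerre_term alpha theta x y)).

Definition laguerre_K (alpha : R) (theta : H) (x y : R) : H :=
  laguerre_weight alpha x *: laguerre_R alpha theta x y.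

Definition laguerre_transform (alpha : R) (theta : H) (phi : R -> H) : R -> H :=
  fun y => qintegral Rplus (fun x => laguerre_K alpha theta x y * phi x).

(** [T], defined on functions, is a well-defined map of L^{2,alpha}_H into
    itself, i.e. it preserves membership and a.e. equality. *)
Definition maps_L2 (alpha : R) (T : (R -> H) -> R -> H) : Prop :=
  (forall phi, L2 alpha phi -> L2 alpha (T phi)) /\
  (forall phi psi, L2 alpha phi -> L2 alpha psi ->
     phi = psi %[ae mu in Rplus] -> T phi = T psi %[ae mu in Rplus]).

Definition L2_continuous (alpha : R) (T : (R -> H) -> R -> H) : Prop :=
  forall phi, L2 alpha phi -> forall e : R, 0 < e ->
    exists2 d : R, 0 < d &
      forall psi, L2 alpha psi ->
        L2norm alpha (psi - phi) < d -> L2norm alpha (T psi - T phi) < e.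

End Laguerre.

(* Main.v *)
Require Import Defs.
From mathcomp Require Import all_boot all_order all_algebra.
From mathcomp Require Import ring lra.
From mathcomp Require Import all_classical all_reals all_analysis.
From mathcomp Require Import measurable_realfun.

(** Put [e_n = L_n / sqrt (Gamma (alpha + n + 1) / n!)], the normalized Laguerre
    polynomials, so that the kernel is [K (x, y) = w x * sum_n theta^n e_n x e_n y]
    for the weight [w x = x^alpha exp (- x)].  Everything rests on two facts about
    the [e_n]:
    - they are orthonormal for [w] ([lagfun_orth]);
    - at each [x > 0] the numbers [e_n x ^ 2] grow more slowly than any geometric
      sequence of ratio greater than 1 ([lagfun_cvg]), so that the diagonal series
      [sum_n r^n e_n x ^ 2] converges for all [0 <= r < 1].

    The second fact and the Cauchy-Schwarz inequality bound the partial sums of the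
    kernel by [sqrt (G x * G y)], where [G] is the diagonal series for
    [r = |theta|].  As the integral of [G w] is [1 / (1 - r)], the function [G] gives
    an integrable bound, and dominated convergence ([kernel_integral]) yields, for
    the transform [L],
      [L phi y = sum_n e_n y theta^n a_n], where [a_n = <e_n, phi>].
    Now [sum_n |a_n|^2 <= |phi|^2] by the Bessel inequality, so Cauchy-Schwarz gives
      [|L phi y|^2 <= |phi|^2 * sum_n |theta|^(2 n) e_n y ^ 2]
    ([transform_sqr_le]); integrating this against [w] replaces each [e_n y ^ 2] by 1,
    and the geometric series [1 / (1 - |theta|^2)] appears.  Continuity and
    compatibility with almost everywhere equality follow by linearity.

    Orthonormality comes from Rodrigues' formula by repeated integration by parts.
    Differentiation acts on functions (weight times polynomial) through an operator
    on polynomials, [rodop], so the integrations by parts are algebra once it is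
    known that the integral of a derivative vanishes ([mom_rodop]).  The growth
    bound is read off the coefficients of the polynomials. *)

Import Order.TTheory GRing.Theory Num.Theory.
Import numFieldNormedType.Exports.
Local Open Scope classical_set_scope.
Local Open Scope ring_scope.

Set Implicit Arguments.
Unset Strict Implicit.
Unset Printing Implicit Defensive.

(** * The polynomials of Rodrigues' formula *)

Section rodrigues_poly.
Context {R : realType}.
Implicit Types (a x : R) (p q : {poly R}).

(** The derivative of [x^a exp (- x) p] is [x^(a - 1) exp (- x) (rodop a p)]. *)
Definition rodop a p : {poly R} := 'X * p^`() + (a%:P - 'X) * p.

(** This is [n! L_n^(a)]: the derivatives of Rodrigues' formula lower the
    exponent [n + a] of the weight by one at each step, down to [a]. *)
Fixpoint rodpoly n a : {poly R} :=
  if n is m.+1 then rodop (a + 1) (rodpoly m (a + 1)) else 1.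

Lemma rodopM a p q : rodop a (p * q) = rodop a p * q + 'X * (p * q^`()).
Proof. by rewrite /rodop derivM; ring. Qed.

Lemma coef_rodop a p j :
  (rodop a p)`_j = (a + j%:R) * p`_j - (if j is k.+1 then p`_k else 0).
Proof.
rewrite /rodop coefD mulrBl coefB coefCM !coefXM coef_deriv.
by case: j => [|j] /=; rewrite ?mulr0n; ring.
Qed.

(** The recursion on the coefficients is Pascal's rule. *)
Lemma coef_rodpoly n a j :
  (rodpoly n a)`_j =
    (-1) ^+ j * 'C(n, j)%:R * \prod_(j <= i < n) (a + i.+1%:R).
Proof.
elim: n a j => [|n IH] a j.
  by rewrite /= coef1 big_geq// mulr1; case: j => [|j]; rewrite ?mulr1 ?mulr0.
have shift k : \prod_(k <= i < n) (a + 1 + i.+1%:R) =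
    \prod_(k.+1 <= i < n.+1) (a + i.+1%:R).
  by rewrite big_add1 /=; apply: eq_bigr => i _; rewrite -[in RHS]natr1; ring.
rewrite /= coef_rodop IH shift.
case: j => [|j].
  by rewrite subr0 !bin0 [in RHS]big_ltn//; ring.
rewrite IH shift binS natrD exprS.
have [jn|nj|->] := ltngtP j n.
- by rewrite !(@big_ltn _ _ _ j.+1)// -(natr1 j.+1) -(natr1 j); ring.
- by rewrite !bin_small//; [ring|exact: ltnW].
- by rewrite !big_geq// bin_small// binn; ring.
Qed.

Lemma size_rodpoly n a : (size (rodpoly n a) <= n.+1)%N.
Proof.
by apply/leq_sizeP => j nj; rewrite coef_rodpoly bin_small// mulr0 mul0r.
Qed.

Lemma derivn_rodpoly n m a : (m <= n)%N ->
  (rodpoly m a)^`(n) = ((m == n)%:R * (-1) ^+ n * n`!%:R)%:P.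
Proof.
move=> mn; apply/polyP => i; rewrite coef_derivn coefC.
case: i => [|i].
  rewrite addn0 ffactnn coef_rodpoly eqxx.
  have [<-|neq] := eqVneq m n; first
    by rewrite binn big_geq// !mulr1 mul1r mulr_natr.
  by rewrite bin_small ?ltn_neqAle ?neq// mulr0 !mul0r mul0rn.
rewrite coef_rodpoly bin_small ?mulr0 ?mul0r ?mul0rn//.
by rewrite addnS ltnS (leq_trans mn)// leq_addr.
Qed.

(** One term of the binomial expansion of [(1 + e) ^+ n]. For fixed [j] it
    makes the growth in [n] slower than any geometric one, as [e] is arbitrary.
    *)
Lemma bin_le_expr (e : R) n j : 0 < e ->
  'C(n, j)%:R <= e^-1 ^+ j * (1 + e) ^+ n.
Proof.
move=> e0; rewrite exprVn mulrC ler_pdivlMr ?exprn_gt0//.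
have [jn|nj] := leqP j n; last first.
  by rewrite bin_small// mul0r exprn_ge0// addr_ge0// ltW.
rewrite exprDn (bigD1 (Ordinal (jn : (j < n.+1)%N)))//= expr1n mul1r.
rewrite mulr_natl lerDl sumr_ge0// => i _.
by rewrite expr1n mul1r mulrn_wge0// exprn_ge0// ltW.
Qed.

Lemma prod_ge_fact a j : 0 <= a -> j`!%:R <= \prod_(0 <= i < j) (a + i.+1%:R).
Proof.
move=> a0; rewrite fact_prod natr_prod big_add1 /=.
by apply: ler_prod => i _; rewrite ler0n lerDr a0.
Qed.

Lemma prod_le_bin a m n : 0 <= a -> a <= m%:R ->
  \prod_(0 <= i < n) (a + i.+1%:R) <= n`!%:R * 'C(m + n, m)%:R.
Proof.
move=> a0 am.
have -> : (n`!%:R * 'C(m + n, m)%:R : R) = \prod_(0 <= i < n) (m%:R + i.+1%:R).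
  apply: (@mulIf _ m`!%:R); first by rewrite pnatr_eq0 -lt0n fact_gt0.
  rewrite -mulrA -natrM mulrC -natrM.
  have -> : ('C(m + n, m) * m`! * n`! = (m + n)`!)%N.
    rewrite -mulnA.
    by have := @bin_fact (m + n) m (leq_addr _ _); rewrite addKn.
  elim: n => [|n IH]; first by rewrite addn0 big_geq// mul1r.
  by rewrite addnS factS natrM IH big_nat_recr//= -natrD addnS; ring.
by apply: ler_prod => i _; rewrite addr_ge0// lerD2r.
Qed.

(** The coefficient of [X^j] contains the binomial ['C(n, j)], which costs
    [e^-1 ^+ j * (1 + e) ^+ n], and misses the first [j] factors of the
    product, which are at least [j!] together: the exponential series of [x /
    e] is left. *)
Lemma rodpoly_bound n a x (e : R) : 0 <= a -> 0 <= x -> 0 < e ->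
  `|(rodpoly n a).[x]| <=
    \prod_(0 <= i < n) (a + i.+1%:R) * (1 + e) ^+ n * expR (x / e).
Proof.
move=> a0 x0 e0.
have fpos (i : nat) : 0 < a + i.+1%:R by rewrite ltr_wpDl.
rewrite (horner_coef_wide _ (size_rodpoly n a)).
apply: (le_trans (ler_norm_sum _ _ _)).
apply: (@le_trans _ _ (\sum_(i < n.+1) \prod_(0 <= i < n) (a + i.+1%:R) *
    (1 + e) ^+ n * exp_coeff (x / e) i)); last first.
  rewrite -mulr_sumr ler_wpM2l//.
    rewrite mulr_ge0 ?exprn_ge0 ?addr_ge0 ?(ltW e0)//.
    by apply: prodr_ge0 => i _; apply: ltW.
  have := @exp_coeff_ge0 R.
  have cv := is_cvg_series_exp_coeff (x / e).
  move=> ge0; rewrite -(big_mkord xpredT (exp_coeff (x / e))).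
  apply: (@nondecreasing_cvgn_le R (series (exp_coeff (x / e)))) => //.
  apply/nondecreasing_seqP => k; rewrite !seriesEnat/= big_nat_recr//= lerDl.
  by apply: ge0; rewrite divr_ge0// ltW.
apply: ler_sum => -[j /= jn] _; rewrite coef_rodpoly.
rewrite !normrM normrX normrN normr1 expr1n mul1r normr_nat normrX.
rewrite (ger0_norm x0).
rewrite ger0_norm; last by apply: prodr_ge0 => i _; apply: ltW.
rewrite [leRHS](_ : _ = (e^-1 ^+ j * (1 + e) ^+ n) *
   \prod_(0 <= i < n) (a + i.+1%:R) / j`!%:R * x ^+ j); last first.
  by rewrite /exp_coeff /= exprMn; ring.
apply: ler_wpM2r; first exact: exprn_ge0.
rewrite -mulrA; apply: ler_pM => //.
- by apply: prodr_ge0 => i _; apply: ltW.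
- exact: bin_le_expr.
rewrite ler_pdivlMr ?ltr0n ?fact_gt0// mulrC [leRHS](big_cat_nat (n := j))//=.
apply: ler_wpM2r; first by apply: prodr_ge0 => i _; apply: ltW.
exact: prod_ge_fact.
Qed.

End rodrigues_poly.

(** * Integrals of polynomials against the weight *)

Section gamma_integrals.
Context {R : realType}.
Local Notation mu := (@lebesgue_measure R).
Local Notation w := (@laguerre_weight R).
Implicit Types (a s x : R) (p q : {poly R}).

Lemma measurable_Rplus : measurable (@Rplus R : set (measurableTypeR R)).
Proof. exact: measurable_itv. Qed.

Lemma in_Rplus x : Rplus x = (0 < x) :> Prop.
Proof. by rewrite /Rplus /= in_itv /= andbT. Qed.

Lemma weight_gt0 a x : 0 < x -> 0 < w a x.
Proof. by move=> x0; rewrite mulr_gt0 ?powR_gt0 ?expR_gt0. Qed.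

Lemma weightS a x : 0 < x -> w (a + 1) x = x * w a x.
Proof.
move=> x0; rewrite /laguerre_weight powRD; last by rewrite (gt_eqF x0) implybT.
by rewrite powRr1 ?ltW//; ring.
Qed.

Lemma is_derive_weight a x : 0 < x ->
  is_derive x 1 (w (a + 1)) ((a + 1 - x) * w a x).
Proof.
move=> x0.
have d1 := @is_derive1_powR R (a + 1) x x0.
have d2 : is_derive x 1 (fun t : R => expR (- t)) (- expR (- x)).
  by apply: trigger_derive; rewrite ?mulr1//=; ring.
have d := is_deriveM d1 d2.
apply: (@is_derive_eq _ _ _ _ _ _ _ _ d).
rewrite /GRing.scale /= addrK /laguerre_weight powRD; last first.
  by rewrite (gt_eqF x0) implybT.
by rewrite powRr1 ?ltW//; ring.
Qed.

Lemma continuous_weight a x : 0 < x -> {for x, continuous (w a)}.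
Proof.
move=> x0; have := @is_derive_weight (a - 1) x x0; rewrite subrK => -[d _].
by apply: differentiable_continuous; apply/derivable1_diffP.
Qed.

Lemma measurable_weight a : measurable_fun Rplus (w a).
Proof.
apply: open_continuous_measurable_fun; first exact: interval_open.
by move=> x; rewrite inE in_Rplus => x0; exact: continuous_weight.
Qed.

Lemma weight_le_exp a : 0 <= a ->
  exists2 C, 0 <= C & forall x, 0 < x -> w a x <= C * expR (- (x / 2)).
Proof.
move=> a0; set m := (Num.trunc a).+1.
have am : a <= m%:R by rewrite ltW// truncnS_gt.
(* the constant comes from the term of order m in the series of exp (x / 2) *)
exists (2 ^+ m * m`!%:R) => [|x x0]; first by rewrite mulr_ge0 ?exprn_ge0.
rewrite /laguerre_weight [in expR (- x)](splitr x) opprD expRD mulrA.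
apply: ler_wpM2r; first exact: expR_ge0.
have F : (1 : R) <= 2 ^+ m * m`!%:R.
  by rewrite mulr_ege1 ?exprn_ege1 ?ler1n ?fact_gt0.
rewrite expRN ler_pdivrMr ?expR_gt0//.
have [x1|x1] := leP 1 x; last first.
  apply: (@le_trans _ _ 1).
    have := @ge0_ler_powR R a a0 x 1; rewrite powR1 !nnegrE.
    by apply => //; exact: ltW.
  by rewrite mulr_ege1// -expR0 ler_expR divr_ge0// ltW.
apply: (@le_trans _ _ (x ^+ m)).
  by rewrite -powR_mulrn ?(ltW x0)// ler_powR.
have h := @expR_ge1Dxn R (x / 2) (Num.trunc a) (divr_ge0 (ltW x0) (ler0n _ _)).
have {h} h : (x / 2) ^+ m / m`!%:R <= expR (x / 2) by lra.
rewrite ler_pdivrMr ?ltr0n ?fact_gt0// in h.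
rewrite [leRHS](_ : _ = 2 ^+ m * (expR (x / 2) * m`!%:R)); last by ring.
apply: le_trans (ler_wpM2l _ h); last exact: exprn_ge0.
by rewrite -exprMn mulrC divfK.
Qed.

Lemma integrable_exp_half :
  mu.-integrable Rplus (fun x => (expR (- (x / 2)))%:E).
Proof.
have h2 : (0 : R) < 1 / 2 by lra.
have int1 := integrableZl measurableT 2 (integrable_exponential_pdf h2).
have int2 := integrableS measurableT measurable_Rplus (@subsetT _ _) int1.
apply: (eq_integrable measurable_Rplus _ _ _ int2).
move=> x; rewrite inE in_Rplus => x0 /=.
rewrite exponential_pdfE ?ltW// -EFinM; congr EFin.
by rewrite mulrA (_ : 2 * (1 / 2) = 1) ?mul1r; [congr expR|]; lra.
Qed.

Lemma integrable_weight a : 0 <= a ->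
  mu.-integrable Rplus (fun x => (w a x)%:E).
Proof.
move=> a0; have [C C0 wC] := weight_le_exp a0.
apply: (le_integrable measurable_Rplus _ _
  (integrableZl measurable_Rplus C integrable_exp_half)).
- by apply/measurable_EFinP; exact: measurable_weight.
move=> x; rewrite in_Rplus => x0 /=.
rewrite lee_fin !ger0_norm ?(ltW (weight_gt0 a x0)) ?mulr_ge0 ?expR_ge0//.
exact: wC.
Qed.

(** The fundamental theorem of calculus on compact intervals that exhaust the
    half-line; [f] itself dominates its restrictions. *)
Lemma integral_derive_eq0 (F f : R -> R) :
  (forall x, 0 < x -> is_derive x 1 F (f x)) ->
  (forall x, 0 < x -> {for x, continuous f}) ->
  mu.-integrable Rplus (EFin \o f) ->
  F n.+2%:R @[n --> \oo] --> 0 -> F n.+2%:R^-1 @[n --> \oo] --> 0 ->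
  \int[mu]_(x in Rplus) f x = 0.
Proof.
move=> dF cf intf Foo F0.
(* the index is shifted by 2 to make the interval nondegenerate for n = 0 *)
pose I (n : nat) : set R := `[n.+2%:R^-1, n.+2%:R]%classic.
have lo (n : nat) : (0 : R) < n.+2%:R^-1 by rewrite invr_gt0.
have lohi (n : nat) : (n.+2%:R^-1 : R) < n.+2%:R.
  by rewrite (@lt_trans _ _ 1)// ?invf_lt1// ltr1n.
have cF x : 0 < x -> {for x, continuous F}.
  by move=> /dF[d _]; apply: differentiable_continuous; apply/derivable1_diffP.
have IR n : I n `<=` Rplus.
  move=> x; rewrite /I /= in_itv/= in_Rplus => /andP[+ _].
  exact: lt_le_trans.
have intI n : (\int[mu]_(x in Rplus) ((EFin \o f) \_ (I n)) x =
    (F n.+2%:R - F n.+2%:R^-1)%:E)%E.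
  rewrite -integral_mkcondr setIidr//.
  rewrite (@continuous_FTC2 _ f F)//.
  - apply: continuous_in_subspaceT => x; rewrite inE => /IR.
    by rewrite in_Rplus; exact: cf.
  - split.
    + move=> x; rewrite in_itv/= => /andP[nx _].
      by have [] := dF x (lt_trans (lo n) nx).
    + exact/cvg_at_right_filter/cF.
    + by apply/cvg_at_left_filter/cF; rewrite (lt_trans (lo n)).
  - move=> x; rewrite in_itv/= => /andP[nx _].
    by rewrite derive1E; have [_ ->] := dF x (lt_trans (lo n) nx).
have mI n : measurable (I n) by exact: measurable_itv.
have mf : measurable_fun Rplus (EFin \o f) by case/integrableP: intf.
have mfI n : measurable_fun Rplus ((EFin \o f) \_ (I n)).
  apply/(measurable_restrict _ (mI n) measurable_Rplus).
  by apply: (measurable_funS measurable_Rplus) mf; exact: subIsetl.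
have cvI : {ae mu, forall x, Rplus x ->
    ((EFin \o f) \_ (I n)) x @[n --> \oo] --> (EFin \o f) x}.
  apply: aeW => x; rewrite in_Rplus => x0.
  apply: cvg_near_cst.
  have [N xN] : exists N : nat, x <= N%:R /\ x^-1 <= N%:R.
    exists (Num.trunc (x + x^-1)).+1.
    have := @truncnS_gt R (x + x^-1); have : 0 < x^-1 by rewrite invr_gt0.
    by move=> ? ?; split; lra.
  near=> n; have Nn : (N <= n)%N by near: n; exact: nbhs_infty_ge.
  rewrite patchE mem_set// /I /= in_itv /=.
  have Nn2 : (N%:R : R) <= n.+2%:R.
    by rewrite ler_nat (leq_trans Nn)// -addn2 leq_addr.
  case: xN => xN1 xN2; rewrite (le_trans xN1)// andbT.
  by rewrite invf_ple ?posrE// (le_trans xN2).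
have domI : {ae mu, forall x n, Rplus x ->
    (`|((EFin \o f) \_ (I n)) x| <= (abse \o (EFin \o f)) x)%E}.
  apply: aeW => x n xR; rewrite patchE; case: ifP => //= _.
  by rewrite normr0 lee_fin.
have [_ _ {}cvI] := dominated_convergence measurable_Rplus mfI mf cvI
  (integrable_abse intf) domI.
rewrite /Rintegral (_ : \int[mu]_(x in Rplus) (f x)%:E = 0)%E//.
have := cvg_unique _ cvI; apply => //.
rewrite (_ : [sequence _]_n = EFin \o (fun n => F n.+2%:R - F n.+2%:R^-1)).
  apply: cvg_EFin; first exact: nearW.
  by rewrite -(subr0 0); exact: cvgB.
by apply/funext => n /=; rewrite intI.
Unshelve. all: by end_near. Qed.


Lemma cvg0_le_harmonic (u : R^nat) C :
  (forall n, 0 <= u n <= C / n.+2%:R) -> u n @[n --> \oo] --> 0.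
Proof.
move=> uC; apply: (@squeeze_cvgr _ _ _ _ (fun=> 0) (fun n => C / n.+2%:R)).
- exact: nearW.
- exact: cvg_cst.
rewrite -(mulr0 C); apply: cvgM; first exact: cvg_cst.
by rewrite (cvg_shiftS (@harmonic R)); exact: cvg_harmonic.
Qed.

Lemma weight_cvgy a : 0 <= a -> w a n.+2%:R @[n --> \oo] --> 0.
Proof.
move=> a0; have [C C0 wC] := weight_le_exp a0.
apply: (@cvg0_le_harmonic _ (C * 2)) => n; set x := n.+2%:R.
have x0 : 0 < x by rewrite ltr0n.
rewrite (ltW (weight_gt0 a x0)) (le_trans (wC _ x0))//= -mulrA ler_wpM2l//.
rewrite expRN -[2 / x]invf_div lef_pV2 ?posrE ?expR_gt0 ?divr_gt0//.
by have := expR_ge1Dx (x / 2); lra.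
Qed.

Lemma weight_cvg0 a : 1 <= a -> w a n.+2%:R^-1 @[n --> \oo] --> 0.
Proof.
move=> a1; apply: (@cvg0_le_harmonic _ 1) => n; set x := n.+2%:R^-1.
have x0 : 0 < x by rewrite invr_gt0.
rewrite (ltW (weight_gt0 a x0)) mul1r/= /laguerre_weight.
have x1 : x <= 1 by rewrite invf_le1// ler1n.
apply: (@le_trans _ _ (x * 1)); last by rewrite mulr1.
apply: ler_pM; rewrite ?powR_ge0 ?expR_ge0//.
  by apply: ge1r_powR; rewrite ?x0.
by rewrite expR_le1 oppr_le0 ltW.
Qed.

Lemma poly_weight_cvgy p a : 0 <= a ->
  p.[n.+2%:R] * w a n.+2%:R @[n --> \oo] --> 0.
Proof.
elim/poly_ind: p a => [|p c IH] a a0.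
  by under eq_fun do rewrite horner0 mul0r; exact: cvg_cst.
rewrite (_ : (fun n => _) = (fun n => p.[n.+2%:R] * w (a + 1) n.+2%:R +
   c * w a n.+2%:R)); last first.
  by apply/funext => n; rewrite hornerMXaddC weightS ?ltr0n//; ring.
rewrite -(addr0 0); apply: cvgD; first by apply: IH; lra.
by rewrite -(mulr0 c); apply: cvgM; [exact: cvg_cst|exact: weight_cvgy].
Qed.

Lemma poly_weight_cvg0 p a : 1 <= a ->
  p.[n.+2%:R^-1] * w a n.+2%:R^-1 @[n --> \oo] --> 0.
Proof.
elim/poly_ind: p a => [|p c IH] a a0.
  by under eq_fun do rewrite horner0 mul0r; exact: cvg_cst.
rewrite (_ : (fun n => _) = (fun n => p.[n.+2%:R^-1] * w (a + 1) n.+2%:R^-1 +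
   c * w a n.+2%:R^-1)); last first.
  by apply/funext => n; rewrite hornerMXaddC weightS ?invr_gt0//; ring.
rewrite -(addr0 0); apply: cvgD; first by apply: IH; lra.
by rewrite -(mulr0 c); apply: cvgM; [exact: cvg_cst|exact: weight_cvg0].
Qed.

Lemma integrable_poly_weight p a : 0 <= a ->
  mu.-integrable Rplus (fun x => (p.[x] * w a x)%:E).
Proof.
elim/poly_ind: p a => [|p c IH] a a0.
  apply: (eq_integrable measurable_Rplus _ _ _ (integrable0 mu Rplus)).
  by move=> x _; rewrite horner0 mul0r.
have a1 : 0 <= a + 1 by lra.
have int1 := integrableD measurable_Rplus (IH _ a1)
  (integrableZl measurable_Rplus c (integrable_weight a0)).
apply: (eq_integrable measurable_Rplus _ _ _ int1) => x.
rewrite inE in_Rplus => x0 /=.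
by rewrite -EFinM -EFinD hornerMXaddC weightS//; congr EFin; ring.
Qed.

(** The linear functional that sends ['X^k] to [Gamma (a + k + 1)]. *)
Definition mom a p : R := \int[mu]_(x in Rplus) (p.[x] * w a x).

Lemma momD a p q : 0 <= a -> mom a (p + q) = mom a p + mom a q.
Proof.
move=> a0; rewrite /mom -RintegralD//; first last.
- exact: integrable_poly_weight.
- exact: integrable_poly_weight.
- exact: measurable_Rplus.
by apply: eq_Rintegral => x _; rewrite hornerD mulrDl.
Qed.

Lemma momZ a c p : 0 <= a -> mom a (c *: p) = c * mom a p.
Proof.
move=> a0; rewrite /mom -RintegralZl//; first last.
- exact: integrable_poly_weight.
- exact: measurable_Rplus.
by apply: eq_Rintegral => x _ /=; rewrite hornerZ; ring.
Qed.

Lemma momX a p : mom a ('X * p) = mom (a + 1) p.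
Proof.
apply: eq_Rintegral => x; rewrite inE in_Rplus => x0.
by rewrite hornerM hornerX weightS//; ring.
Qed.

Lemma is_derive_poly_weight p a x : 0 < x ->
  is_derive x 1 (fun t => w (a + 1) t * p.[t]) (w a x * (rodop (a + 1) p).[x]).
Proof.
move=> x0.
have d := is_deriveM (is_derive_weight a x0) (@is_derive_poly _ p x).
apply: (@is_derive_eq _ _ _ _ _ _ _ _ d).
rewrite /GRing.scale /= weightS// /rodop.
rewrite !(hornerD, hornerM, hornerN, hornerX, hornerC).
ring.
Qed.

(** The integrand is the derivative of [w (a + 1) p], which vanishes at both
    ends. *)
Lemma mom_rodop a p : 0 <= a -> mom a (rodop (a + 1) p) = 0.
Proof.
move=> a0.
apply: (@integral_derive_eq0 (fun t => w (a + 1) t * p.[t])).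
- move=> x x0; rewrite mulrC; exact: is_derive_poly_weight.
- move=> x x0; apply: cvgM; last exact: continuous_weight.
  exact: continuous_horner.
- exact: integrable_poly_weight.
- under eq_fun do rewrite mulrC.
  by apply: poly_weight_cvgy; lra.
- under eq_fun do rewrite mulrC.
  by apply: poly_weight_cvg0; lra.
Qed.

(** Integration by parts [n] times: by the product rule [rodopM] the integral
    of [rodop p * q] is minus that of ['X * (p * q^`())], and the factor ['X]
    raises the exponent of the weight by one. *)
Lemma mom_rodpolyM n a q : 0 <= a ->
  mom a (rodpoly n a * q) = (-1) ^+ n * mom (a + n%:R) q^`(n).
Proof.
elim: n a q => [|n IH] a q a0; first by rewrite addr0 expr0 !mul1r derivn0.
have a1 : 0 <= a + 1 by lra.
rewrite derivSn [rodpoly _.+1 _]/= -natr1 [in RHS]addrA addrAC exprS.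
rewrite -mulrA -IH// -momX.
have := mom_rodop (rodpoly n (a + 1) * q) a0.
rewrite rodopM momD// => /eqP; rewrite addr_eq0 => /eqP ->.
by rewrite mulN1r.
Qed.

Lemma mom1 a n : mom (a + n%:R) 1 = Gamma (a + n%:R + 1).
Proof.
apply: eq_Rintegral => x _.
by rewrite hornerC mul1r addrK.
Qed.

(** The factor of lower degree is killed by the [n] derivatives, and in the
    case of equal degrees only its leading coefficient [(- 1) ^+ n] survives.
    *)
Lemma orthogonal_rodpoly n m a : 0 <= a ->
  mom a (rodpoly n a * rodpoly m a) =
  (n == m)%:R * (n`!%:R * Gamma (a + n%:R + 1)).
Proof.
move=> a0; wlog mn : n m / (m <= n)%N.
  move=> H; have [/H//|nm] := leqP m n.
  rewrite [X in mom a X]mulrC (H m n (ltnW nm)).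
  by rewrite (gtn_eqF nm) (ltn_eqF nm) !mul0r.
rewrite mom_rodpolyM// derivn_rodpoly// -alg_polyC momZ ?mom1; last first.
  by rewrite addr_ge0.
rewrite eq_sym; set X := RHS; have <- : (-1) ^+ n ^+ 2 * X = X.
  by rewrite sqrr_sign mul1r.
by rewrite /X; ring.
Qed.

(** [mom_rodop] for the constant polynomial 1. *)
Lemma GammaS s : 0 <= s -> Gamma (s + 1 + 1) = (s + 1) * Gamma (s + 1).
Proof.
move=> s0.
have := mom_rodop 1 s0.
rewrite /rodop derivC mulr0 add0r mulr1.
have -> : (s + 1)%:P - 'X = (s + 1) *: 1 + (-1) *: ('X * 1) :> {poly R}.
  by rewrite mulr1 scaleN1r alg_polyC.
rewrite momD// !momZ// momX => /eqP; rewrite mulN1r subr_eq0 => /eqP h.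
have := mom1 s 0; rewrite addr0 => <-.
have := mom1 (s + 1) 0; rewrite addr0 => <-.
by [].
Qed.

Lemma GammaE s : Gamma (s + 1) = \int[mu]_(x in Rplus) w s x.
Proof. by apply: eq_Rintegral => x _; rewrite addrK. Qed.

Lemma Gamma_gt0 s : 0 <= s -> 0 < Gamma (s + 1).
Proof.
move=> s0; rewrite GammaE.
have int_w := integrable_weight s0.
have m12 : measurable (`[1, 2]%classic : set (measurableTypeR R)).
  exact: measurable_itv.
rewrite -lte_fin /Rintegral fineK ?integrable_fin_num//; last first.
  exact: measurable_Rplus.
have lo : (0 < \int[mu]_(x in `[1%R, 2%R]) (expR (- 2))%:E)%E.
  rewrite integral_cst//= lebesgue_measure_itv/= lte_fin ltr1n.
  by rewrite -EFinB -EFinM lte_fin mulr_gt0 ?expR_gt0//; lra.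
have sub : `[1, 2]%classic `<=` @Rplus R.
  by move=> x; rewrite /= in_itv/= in_Rplus => /andP[+ _]; exact: lt_le_trans.
apply: (lt_le_trans lo).
apply: (@le_trans _ _ (\int[mu]_(x in `[1%R, 2%R]) (w s x)%:E)%E).
  apply: ge0_le_integral => //.
  - by case/integrableP: (integrableS measurable_Rplus m12 sub int_w).
  move=> x; rewrite /= in_itv/= => /andP[x1 x2]; rewrite lee_fin.
  rewrite -[leLHS]mul1r; apply: ler_pM; rewrite ?expR_ge0 ?ler_expR ?lerN2//.
  by rewrite -[leLHS](powRr0 x); exact: ler_powR.
apply: ge0_subset_integral => //; first exact: measurable_Rplus.
- by case/integrableP: int_w.
- by move=> x; rewrite in_Rplus => x0; rewrite lee_fin ltW// weight_gt0.
Qed.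

Lemma Gamma_prod a n : 0 <= a ->
  Gamma (a + n%:R + 1) = Gamma (a + 1) * \prod_(0 <= i < n) (a + i.+1%:R).
Proof.
move=> a0; elim: n => [|n IH]; first by rewrite addr0 big_geq// mulr1.
rewrite big_nat_recr//= mulrA -IH -natr1 addrA GammaS; last by rewrite addr_ge0.
by rewrite mulrC.
Qed.

(** The exponent is written [n + a] so that the induction can pass from [a] to
    [a + 1], leaving one derivative to be taken. *)
Lemma derive1n_rodrigues n a x : 0 < x ->
  derive1n n (fun t : R => t `^ (n%:R + a) * expR (- t)) x =
  w a x * (rodpoly n a).[x].
Proof.
elim: n a x => [|n IH] a x x0.
  by rewrite /= add0r hornerC mulr1.
rewrite derive1nS derive1E.
rewrite (@near_eq_derive _ _ _ _
  (fun t => w (a + 1) t * (rodpoly n (a + 1)).[t])).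
  by have [_ ->] := is_derive_poly_weight (rodpoly n (a + 1)) a x0.
near=> t; have t0 : 0 < t by near: t; exact: lt_nbhsr.
rewrite -IH//; congr (derive1n n _ t); apply/funext => u.
by rewrite -natr1 addrAC addrA.
Unshelve. all: by end_near. Qed.

Lemma laguerreE a n x : 0 < x -> laguerre a n x = (rodpoly n a).[x] / n`!%:R.
Proof.
move=> x0; rewrite /laguerre derive1n_rodrigues// /laguerre_weight.
have xa : x `^ a != 0 by rewrite gt_eqF// powR_gt0.
have ex : expR x != 0 by rewrite gt_eqF// expR_gt0.
have nf : n`!%:R != 0 :> R by rewrite pnatr_eq0 -lt0n fact_gt0.
by rewrite powRN expRN; field; rewrite xa ex nf.
Qed.

End gamma_integrals.

(** * Mehler kernels of an orthonormal system *)

Lemma CauchySchwarz_sum (R : realFieldType) (a b : nat -> R) N :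
  (\sum_(0 <= n < N) a n * b n) ^+ 2 <=
  (\sum_(0 <= n < N) a n ^+ 2) * (\sum_(0 <= n < N) b n ^+ 2).
Proof.
elim: N => [|N IH]; first by rewrite !big_geq// expr0n mul0r.
rewrite !big_nat_recr//=.
set A := \sum_(0 <= n < N) _ ^+ 2 in IH *.
set B := \sum_(0 <= n < N) b _ ^+ 2 in IH *.
set S := \sum_(0 <= n < N) _ * _ in IH *.
set x := a N; set y := b N.
have A0 : 0 <= A by apply: sumr_ge0 => i _; exact: sqr_ge0.
have B0 : 0 <= B by apply: sumr_ge0 => i _; exact: sqr_ge0.
have h : 2 * (S * (x * y)) <= A * y ^+ 2 + x ^+ 2 * B.
  have P0 : 0 <= A * y ^+ 2 + x ^+ 2 * B.
    by rewrite addr_ge0// mulr_ge0// sqr_ge0.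
  apply: (le_trans (ler_norm _)); rewrite -(@ler_pXn2r _ 2) ?nnegrE//.
  rewrite real_normK ?num_real//.
  have := sqr_ge0 (A * y ^+ 2 - x ^+ 2 * B).
  have := ler_wpM2r (sqr_ge0 (x * y)) IH; clearbody A B S x y; nra.
have := IH; clearbody A B S x y; lra.
Qed.


(** [mehler_kernel] on the diagonal, for the geometric sequence of ratio [r];
    its finiteness controls all kernels whose coefficients are bounded by [r ^+
    n]. *)
Definition mehler_diag (T : Type) (R : realType) (e : nat -> T -> R)
    (r : R) x : R :=
  limn (series (fun n => r ^+ n * e n x ^+ 2)).

(** The coefficients [t] are arbitrary reals, not powers: they are to be the
    coordinates of the powers of a quaternion. *)
Definition mehler_kernel (T : Type) (R : realType) (e : nat -> T -> R)
    (t : nat -> R) x y : R :=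
  limn (series (fun n => t n * e n x * e n y)).

Section weighted_L2.
Context d (T : measurableType d) (R : realType).
Variables (mu : {measure set T -> \bar R}) (D : set T) (w : T -> R).
Hypothesis mD : measurable D.
Hypothesis w_ge0 : forall x, D x -> 0 <= w x.
Hypothesis mw : measurable_fun D w.
Implicit Types f g h : T -> R.

Definition sqint f :=
  measurable_fun D f /\ mu.-integrable D (fun x => (f x ^+ 2 * w x)%:E).

Definition ip f g : R := \int[mu]_(x in D) (f x * g x * w x).

Lemma sqint_ip f g : sqint f -> sqint g ->
  mu.-integrable D (fun x => (f x * g x * w x)%:E).
Proof.
move=> [mf intf] [mg intg].
apply: (le_integrable mD _ _ (integrableD mD intf intg)).
  apply/measurable_EFinP; apply: measurable_funM => //.
  exact: measurable_funM.
move=> x Dx /=; have w0 := w_ge0 Dx.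
rewrite lee_fin -mulrDl [leRHS]ger0_norm; last first.
  by rewrite mulr_ge0// addr_ge0// sqr_ge0.
rewrite normrM (ger0_norm w0) ler_wpM2r// ler_norml.
have := sqr_ge0 (f x - g x); have := sqr_ge0 (f x + g x).
by have := sqr_ge0 (f x); have := sqr_ge0 (g x); nra.
Qed.

Lemma sqintB f g c : sqint f -> sqint g -> sqint (fun x => f x - c * g x).
Proof.
move=> sf sg; have [[mf intf] [mg intg]] := (sf, sg).
split; first by apply: measurable_funB => //; exact: measurable_funM.
have i1 := integrableZl mD (- (c *+ 2)) (sqint_ip sf sg).
have i2 := integrableZl mD (c ^+ 2) intg.
apply: (eq_integrable mD _ _ _ (integrableD mD (integrableD mD intf i1) i2)).
by move=> x _ /=; rewrite -!EFinM -!EFinD; congr EFin; ring.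
Qed.

Lemma ipC f g : ip f g = ip g f.
Proof. by apply: eq_Rintegral => x _; rewrite (mulrC (f x)). Qed.

Lemma ipB f g h c : sqint f -> sqint g -> sqint h ->
  ip (fun x => f x - c * g x) h = ip f h - c * ip g h.
Proof.
move=> sf sg sh; have i1 := sqint_ip sf sh; have i2 := sqint_ip sg sh.
rewrite /ip -RintegralZl// -RintegralB//; last exact: (integrableZl mD c i2).
by apply: eq_Rintegral => x _ /=; ring.
Qed.

Lemma ip_ge0 f : 0 <= ip f f.
Proof.
by apply: Rintegral_ge0 => x Dx; rewrite mulr_ge0 ?w_ge0// -expr2 sqr_ge0.
Qed.

Variable e : nat -> T -> R.
Hypothesis e_sqint : forall n, sqint (e n).
Hypothesis e_orth : forall m n, ip (e m) (e n) = (m == n)%:R.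

(** Subtracting from [f] its components along [e 0, e 1, ...] one at a time
    leaves [g], whose square norm is that of [f] minus the sum of the squared
    coefficients. *)
Lemma Bessel_inequality f N : sqint f ->
  \sum_(0 <= n < N) ip (e n) f ^+ 2 <= ip f f.
Proof.
move=> sf.
have [g [_ _]] : exists g, [/\ sqint g,
    forall n, (N <= n)%N -> ip (e n) g = ip (e n) f &
    ip g g = ip f f - \sum_(0 <= n < N) ip (e n) f ^+ 2].
  elim: N => [|N [g [sg ge gg]]]; first by exists f; rewrite big_geq ?subr0.
  have eN := e_sqint N; set c := ip (e N) f.
  have gN : ip (e N) g = c by exact: ge.
  have sg' := sqintB c sg eN.
  exists (fun x => g x - c * e N x); split => //.
    move=> n Nn; rewrite ipC ipB// ipC ge ?(ltnW Nn)// e_orth.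
    by rewrite ltn_eqF// mulr0 subr0.
  have gg' := ipB c sg eN sg.
  have eg' := ipB c sg eN eN.
  rewrite (ipB c sg eN sg') (ipC g) (ipC (e N)) gg' eg' e_orth eqxx.
  by rewrite (ipC g) gN gg big_nat_recr//= -/c; ring.
by have := ip_ge0 g => + gE; rewrite gE subr_ge0.
Qed.

Hypothesis e_cvg : forall (r : R) x, 0 <= r < 1 -> D x ->
  cvgn (series (fun n => r ^+ n * e n x ^+ 2)).

Local Notation diag := (mehler_diag e).

Lemma diag_ge (r : R) x N : 0 <= r < 1 -> D x ->
  \sum_(0 <= n < N) r ^+ n * e n x ^+ 2 <= diag r x.
Proof.
move=> r01 Dx; have /andP[r0 _] := r01.
apply: (@nondecreasing_cvgn_le R (series (fun n => r ^+ n * e n x ^+ 2))).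
  apply/nondecreasing_seqP => n; rewrite !seriesEnat/= big_nat_recr//= lerDl.
  by rewrite mulr_ge0 ?sqr_ge0 ?exprn_ge0.
exact: e_cvg.
Qed.

Lemma diag_ge0 (r : R) x : 0 <= r < 1 -> D x -> 0 <= diag r x.
Proof. by move=> r01 Dx; have := diag_ge 0 r01 Dx; rewrite big_geq. Qed.

Let me n : measurable_fun D (e n). Proof. by have [] := e_sqint n. Qed.

Lemma measurable_diag (r : R) : 0 <= r < 1 -> measurable_fun D (diag r).
Proof.
move=> r01; apply: (@measurable_fun_cvg _ _ _ _
    (fun N x => \sum_(0 <= n < N) r ^+ n * e n x ^+ 2)).
  move=> N; apply: measurable_sum => n; apply: measurable_funM => //.
  exact/measurable_funX/me.
by move=> x Dx; exact: e_cvg.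
Qed.

(** Term by term, each [e n] having norm 1, this is the geometric series. *)
Lemma integral_diag (r : R) : 0 <= r < 1 ->
  (\int[mu]_(x in D) (diag r x * w x)%:E = ((1 - r)^-1)%:E)%E.
Proof.
move=> /[dup] r01 /andP[r0 r1].
have term_ge0 n x : D x -> 0 <= r ^+ n * e n x ^+ 2 * w x.
  by move=> Dx; rewrite mulr_ge0 ?w_ge0// mulr_ge0 ?sqr_ge0 ?exprn_ge0.
transitivity (\int[mu]_(x in D)
    \sum_(0 <= n <oo) (r ^+ n * e n x ^+ 2 * w x)%:E)%E.
  apply: eq_integral => x; rewrite inE => Dx; apply/esym/cvg_lim => //.
  rewrite (_ : (fun N => _) = EFin \o
      (fun N => series (fun n => r ^+ n * e n x ^+ 2) N * w x)).
    apply: cvg_EFin; first exact: nearW.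
    by apply: cvgM; [exact: e_cvg|exact: cvg_cst].
  by apply/funext => N /=; rewrite sumEFin -mulr_suml.
rewrite integral_nneseries//; last first.
  move=> n; apply/measurable_EFinP; apply: measurable_funM => //.
  by apply: measurable_funM => //; exact/measurable_funX/me.
have termE n :
    (\int[mu]_(x in D) (r ^+ n * e n x ^+ 2 * w x)%:E = (r ^+ n)%:E)%E.
  have [_ int_e] := e_sqint n.
  under eq_integral do rewrite -mulrA EFinM.
  rewrite integralZl//.
  have -> : (\int[mu]_(x in D) (e n x ^+ 2 * w x)%:E = (ip (e n) (e n))%:E)%E.
    by rewrite /ip /Rintegral fineK ?integrable_fin_num.
  by rewrite e_orth eqxx mule1.
under eq_eseriesr do rewrite termE.
apply/cvg_lim => //.
rewrite (_ : (fun N => _) = EFin \o (series (geometric 1 r))).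
  apply: cvg_EFin; first exact: nearW.
  rewrite -[X in _ --> X]mul1r.
  by apply: cvg_geometric_series; rewrite ger0_norm.
apply/funext => N /=; rewrite sumEFin; congr EFin.
by apply: eq_bigr => i _; rewrite /= mul1r.
Qed.

Lemma integrable_diag (r : R) : 0 <= r < 1 ->
  mu.-integrable D (fun x => (diag r x * w x)%:E).
Proof.
move=> r01; apply/integrableP; split.
  apply/measurable_EFinP; apply: measurable_funM => //.
  exact: measurable_diag.
under eq_integral => x /[!inE] Dx.
  rewrite gee0_abs; last by rewrite lee_fin mulr_ge0 ?w_ge0 ?diag_ge0.
  over.
by rewrite integral_diag// ltry.
Qed.

Section kernel.
Variables (r : R) (t : nat -> R).
Hypothesis r01 : 0 <= r < 1.
Hypothesis tr : forall n, `|t n| <= r ^+ n.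

Local Notation kernel := (mehler_kernel e t).

Let r0 : 0 <= r. Proof. by case/andP: r01. Qed.

Lemma is_cvg_kernel x y : D x -> D y ->
  cvgn (series (fun n => t n * e n x * e n y)).
Proof.
move=> Dx Dy; apply: normed_cvg.
apply: (@series_le_cvg _ _
  (fun n => r ^+ n * e n x ^+ 2 + r ^+ n * e n y ^+ 2)).
- by move=> n /=; exact: normr_ge0.
- by move=> n; rewrite addr_ge0// mulr_ge0 ?sqr_ge0 ?exprn_ge0.
- move=> n /=; rewrite -mulrDr -mulrA normrM; apply: ler_pM => //.
  rewrite ler_norml.
  have := sqr_ge0 (e n x - e n y); have := sqr_ge0 (e n x + e n y).
  by have := sqr_ge0 (e n x); have := sqr_ge0 (e n y); nra.
rewrite (_ : series _ = series (fun n => r ^+ n * e n x ^+ 2) +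
    series (fun n => r ^+ n * e n y ^+ 2)).
  by apply: is_cvgD; exact: e_cvg.
by apply/funext => N; rewrite /series/= big_split.
Qed.

(** Cauchy-Schwarz, the coefficient [r ^+ n] being shared equally between the
    two factors; the bound does not depend on [N]. *)
Lemma kernel_sum_le x y N : D x -> D y ->
  (\sum_(0 <= n < N) t n * e n x * e n y) ^+ 2 <= diag r x * diag r y.
Proof.
move=> Dx Dy.
have rt n : `|t n| <= Num.sqrt (r ^+ n) * Num.sqrt (r ^+ n).
  by rewrite -expr2 sqr_sqrtr ?exprn_ge0.
apply: (@le_trans _ _
  ((\sum_(0 <= n < N) (Num.sqrt (r ^+ n) * `|e n x|) *
                      (Num.sqrt (r ^+ n) * `|e n y|)) ^+ 2)).
  rewrite -[leLHS]real_normK ?num_real// ler_pXn2r ?nnegrE//; last first.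
    by apply: sumr_ge0 => n _; rewrite !mulr_ge0 ?sqrtr_ge0.
  apply: (le_trans (ler_norm_sum _ _ _)); apply: ler_sum => n _.
  rewrite !normrM mulrACA -mulrA; apply: ler_wpM2r; last exact: rt.
  by rewrite mulr_ge0.
apply: (le_trans (CauchySchwarz_sum _ _ _)).
have sqE z : \sum_(0 <= n < N) (Num.sqrt (r ^+ n) * `|e n z|) ^+ 2 =
    \sum_(0 <= n < N) r ^+ n * e n z ^+ 2.
  apply: eq_bigr => n _.
  by rewrite exprMn sqr_sqrtr ?exprn_ge0// real_normK ?num_real.
rewrite !sqE; apply: ler_pM; rewrite ?diag_ge//;
  by apply: sumr_ge0 => n _; rewrite mulr_ge0 ?sqr_ge0 ?exprn_ge0.
Qed.

Lemma measurable_kernel y : D y -> measurable_fun D (kernel ^~ y).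
Proof.
move=> Dy; apply: (@measurable_fun_cvg _ _ _ _
    (fun N x => \sum_(0 <= n < N) t n * e n x * e n y)).
  move=> N; apply: measurable_sum => n; apply: measurable_funM => //.
  by apply: measurable_funM => //; exact: me.
by move=> x Dx; exact: is_cvg_kernel.
Qed.

(** The kernel operator is diagonal in the system [e]. Sum and integral are
    exchanged by dominated convergence: by [kernel_sum_le] and the inequality
    [|s f| <= s ^+ 2 + f ^+ 2] the partial sums are bounded by [(diag r y *
    diag r x + f x ^+ 2) * w x], integrable in [x]. *)
Lemma kernel_integral f y : sqint f -> D y ->
  mu.-integrable D (fun x => (w x * (kernel x y * f x))%:E) /\
  (\sum_(0 <= n < N) t n * ip (e n) f * e n y) @[N --> \oo] -->
    \int[mu]_(x in D) (w x * (kernel x y * f x)).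
Proof.
move=> sf Dy; have [mf intf] := sf.
pose F N x := w x * ((\sum_(0 <= n < N) t n * e n x * e n y) * f x).
have FE N : mu.-integrable D (EFin \o F N) /\
    \int[mu]_(x in D) F N x = \sum_(0 <= n < N) t n * ip (e n) f * e n y.
  elim: N => [|N [intF IH]].
    have F0 : F 0 = cst 0.
      by apply/funext => x; rewrite /F big_geq// mul0r mulr0.
    rewrite F0 big_geq//; split; first exact: integrable0.
    by rewrite Rintegral_cst// mul0r.
  have i1 := integrableZl mD (t N * e N y) (sqint_ip (e_sqint N) sf).
  have FS x : F N.+1 x = F N x + t N * e N y * (e N x * f x * w x).
    by rewrite /F big_nat_recr//=; ring.
  split.
    apply: (eq_integrable mD _ _ _ (integrableD mD intF i1)) => x _ /=.
    by rewrite FS -EFinM -EFinD.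
  under eq_Rintegral do rewrite FS.
  rewrite RintegralD// RintegralZl//; last exact: sqint_ip.
  by rewrite IH big_nat_recr//= -/(ip _ _); ring.
have mker := measurable_kernel Dy.
have mF N : measurable_fun D (EFin \o F N) by have [/integrableP[]] := FE N.
have mlim : measurable_fun D (fun x => (w x * (kernel x y * f x))%:E).
  apply/measurable_EFinP; apply: measurable_funM => //.
  exact: measurable_funM.
have cvF : {ae mu, forall x, D x ->
    (EFin \o F N) x @[N --> \oo] --> (w x * (kernel x y * f x))%:E}.
  apply: aeW => x Dx; apply: cvg_EFin; first exact: nearW.
  apply: cvgM; first exact: cvg_cst.
  by apply: cvgM; [exact: is_cvg_kernel|exact: cvg_cst].
pose G x := diag r y * (diag r x * w x) + f x ^+ 2 * w x.
have intG : mu.-integrable D (EFin \o G).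
  have i1 := integrableZl mD (diag r y) (integrable_diag r01).
  by apply: (eq_integrable mD _ _ _ (integrableD mD i1 intf)).
have domF : {ae mu, forall x N, D x -> (`|(EFin \o F N) x| <= (EFin \o G) x)%E}.
  apply: aeW => x N Dx /=; rewrite lee_fin /F /G; have w0 := w_ge0 Dx.
  have := kernel_sum_le N Dx Dy; set s := \sum_(0 <= n < N) _ => sxy.
  rewrite normrM (ger0_norm w0) mulrA -mulrDl mulrC ler_wpM2r// ler_norml.
  have := sqr_ge0 (s - f x); have := sqr_ge0 (s + f x).
  by have := sqr_ge0 s; have := sqr_ge0 (f x); nra.
have [intL _ cvL] := dominated_convergence mD mF mlim cvF intG domF.
split => //.
rewrite (_ : (fun N => _) =
  fine \o (fun N => \int[mu]_(x in D) (EFin \o F N) x)%E).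
  by apply: fine_cvg; rewrite /Rintegral fineK// integrable_fin_num.
by apply/funext => N /=; rewrite -(FE N).2.
Qed.

End kernel.
End weighted_L2.

(** * The orthonormal system of Laguerre polynomials *)

Section laguerre_system.
Context {R : realType}.
Variable alpha : R.
Hypothesis alpha0 : 0 <= alpha.
Local Notation mu := (@lebesgue_measure R).
Local Notation w := (laguerre_weight alpha).

Definition lagfun n (x : R) : R :=
  (rodpoly n alpha).[x] / Num.sqrt (n`!%:R * Gamma (alpha + n%:R + 1)).

Lemma lagnorm_gt0 n : 0 < n`!%:R * Gamma (alpha + n%:R + 1).
Proof. by rewrite mulr_gt0 ?ltr0n ?fact_gt0// Gamma_gt0// addr_ge0. Qed.

Lemma weight_ge0 x : Rplus x -> 0 <= w x.
Proof. by rewrite in_Rplus => x0; rewrite ltW// weight_gt0. Qed.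

Lemma lagfun_sqint n : sqint mu Rplus w (lagfun n).
Proof.
split.
  apply: measurable_funM => //.
  apply: measurable_funTS; apply: continuous_measurable_fun.
  exact: continuous_horner.
have := integrable_poly_weight
  ((n`!%:R * Gamma (alpha + n%:R + 1))^-1 *: rodpoly n alpha ^+ 2) alpha0.
apply: eq_integrable; first exact: measurable_Rplus.
move=> x _; congr (_ * _)%:E.
rewrite /lagfun expr_div_n sqr_sqrtr ?(ltW (lagnorm_gt0 n))//.
by rewrite hornerZ horner_exp mulrC.
Qed.

Lemma lagfun_orth m n : ip mu Rplus w (lagfun m) (lagfun n) = (m == n)%:R.
Proof.
set c := fun n => Num.sqrt (n`!%:R * Gamma (alpha + n%:R + 1)).
have c0 k : c k != 0 by rewrite gt_eqF// sqrtr_gt0 lagnorm_gt0.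
transitivity (mom alpha
    (((c m)^-1 * (c n)^-1) *: (rodpoly m alpha * rodpoly n alpha))).
  have aux (a b c1 c2 v : R) :
      a / c1 * (b / c2) * v = c1^-1 * c2^-1 * (a * b) * v.
    by rewrite (mulrACA a) [a * b * _]mulrC.
  by apply: eq_Rintegral => x _; rewrite hornerZ hornerM; exact: aux.
rewrite momZ// orthogonal_rodpoly//.
have [->|] := eqVneq m n; last by rewrite mul0r mulr0.
rewrite mul1r -[X in _ * X]sqr_sqrtr ?(ltW (lagnorm_gt0 n))// -/(c n).
by rewrite -invfM -expr2 mulVf// expf_neq0.
Qed.

(** [rodpoly_bound] contributes two factors [(1 + eps) ^+ n]. The third one
    bounds the product of the [1 + alpha / i], [1 <= i <= n], which remains
    after division by [n! Gamma (alpha + n + 1)]: it is at most ['C(m + n, m)]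
    for any natural number [m >= alpha]. *)
Lemma lagfun_growth x (eps : R) : 0 <= x -> 0 < eps ->
  exists2 C, 0 <= C & forall n, lagfun n x ^+ 2 <= C * ((1 + eps) ^+ 3) ^+ n.
Proof.
move=> x0 e0; set m := (Num.trunc alpha).+1.
have am : alpha <= m%:R by rewrite ltW// truncnS_gt.
have e1 : 0 < 1 + eps by lra.
set E := expR (x / eps).
exists (eps^-1 ^+ m * (1 + eps) ^+ m * E ^+ 2 / Gamma (alpha + 1)) => [|n].
  rewrite divr_ge0 ?(ltW (Gamma_gt0 _))//.
  by rewrite !mulr_ge0 ?exprn_ge0 ?invr_ge0 ?expR_ge0// ltW.
set P := \prod_(0 <= i < n) (alpha + i.+1%:R).
have P0 : 0 < P by apply: prodr_gt0 => i _; rewrite ltr_wpDl.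
have G0 := Gamma_gt0 alpha0.
have f0 : 0 < n`!%:R :> R by rewrite ltr0n fact_gt0.
rewrite /lagfun expr_div_n sqr_sqrtr ?(ltW (lagnorm_gt0 n))// Gamma_prod// -/P.
have rb := rodpoly_bound n alpha0 x0 e0; rewrite -/P -/E in rb.
have rb2 : (rodpoly n alpha).[x] ^+ 2 <= (P * (1 + eps) ^+ n * E) ^+ 2.
  rewrite -[leLHS]real_normK ?num_real// ler_pXn2r// nnegrE.
  by rewrite (le_trans _ rb).
rewrite ler_pdivrMr ?mulr_gt0//; apply: (le_trans rb2).
have PB : P <= n`!%:R * (eps^-1 ^+ m * (1 + eps) ^+ (m + n)).
  apply: (le_trans (prod_le_bin n alpha0 am)).
  by rewrite ler_pM2l//; exact: bin_le_expr.
rewrite [leLHS](_ : _ = P * ((1 + eps) ^+ n ^+ 2 * E ^+ 2) * P); last by ring.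
rewrite [leRHS](_ : _ = n`!%:R * (eps^-1 ^+ m * (1 + eps) ^+ (m + n)) *
   ((1 + eps) ^+ n ^+ 2 * E ^+ 2) * P); last first.
  have -> : ((1 + eps) ^+ 3) ^+ n = ((1 + eps) ^+ n) ^+ 3.
    by rewrite -!exprM mulnC.
  move: (gt_eqF G0) => G1; rewrite exprD; field.
  by rewrite G1.
apply: ler_wpM2r; first exact: ltW.
by apply: ler_wpM2r => //; rewrite mulr_ge0 ?sqr_ge0.
Qed.

Lemma lagfun_cvg (r x : R) : 0 <= r < 1 -> Rplus x ->
  cvgn (series (fun n => r ^+ n * lagfun n x ^+ 2)).
Proof.
move=> /andP[r0 r1]; rewrite in_Rplus => x0.
(* (1 + eps) ^ 3 <= 1 + 7 eps as eps <= 1, so r (1 + eps) ^ 3 <= r + 7 eps < 1 *)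
pose eps := (1 - r) / 8.
have e0 : 0 < eps by rewrite /eps; lra.
have [C C0 gC] := lagfun_growth (ltW x0) e0.
pose q := r * (1 + eps) ^+ 3.
have q0 : 0 <= q by rewrite mulr_ge0// exprn_ge0//; lra.
have q1 : q < 1.
  apply: (@le_lt_trans _ _ (r + 7 * eps)); last by rewrite /eps; lra.
  have : (1 + eps) ^+ 3 <= 1 + 7 * eps.
    have e1 : eps <= 1 by rewrite /eps; lra.
    have e2 : eps ^+ 2 <= eps by rewrite expr2 ger_pMr.
    have e3 : eps ^+ 3 <= eps by rewrite exprS ger_pMr// (le_trans e2).
    rewrite (_ : (1 + eps) ^+ 3 = 1 + 3 * eps + 3 * eps ^+ 2 + eps ^+ 3).
      by lra.
    by ring.
  move=> /(ler_wpM2l r0) /le_trans; apply; rewrite mulrDr mulr1 lerD2l.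
  by apply: ler_piMl; [lra|exact: ltW].
apply: (@series_le_cvg _ _ (geometric C q)).
- by move=> n; rewrite mulr_ge0 ?sqr_ge0 ?exprn_ge0.
- by move=> n; rewrite /= mulr_ge0 ?exprn_ge0.
- move=> n /=; rewrite [q ^+ n]exprMn (mulrCA C).
  apply: ler_wpM2l; first exact: exprn_ge0.
  exact: gC.
by apply: is_cvg_geometric_series; rewrite ger0_norm.
Qed.

End laguerre_system.

(** * Norm and convergence of quaternions *)

Section quaternion_theory.
Context {R : realType}.
Local Notation H := (quaternion R).
Implicit Types p q : H.

Lemma quat_norm_sqr q :
  `|q| ^+ 2 = qre q ^+ 2 + qi q ^+ 2 + qj q ^+ 2 + qk q ^+ 2.
Proof. by rewrite Defs.normqE sqr_sqrtr// !addr_ge0// sqr_ge0. Qed.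

Lemma quat_normM p q : `|p * q| = `|p| * `|q|.
Proof.
apply: (@pexpIrn _ 2) => //; rewrite ?nnegrE ?mulr_ge0//.
by rewrite exprMn !quat_norm_sqr /=; ring.
Qed.

Lemma quat_normX q n : `|q ^+ n| = `|q| ^+ n.
Proof.
elim: n => [|n IH]; last by rewrite !exprS quat_normM IH.
by rewrite !expr0 Defs.normqE /= expr0n expr1n !addr0 sqrtr1.
Qed.

Lemma quat_coord_le_norm q :
  [/\ `|qre q| <= `|q|, `|qi q| <= `|q|, `|qj q| <= `|q| & `|qk q| <= `|q|].
Proof.
have le x : x ^+ 2 <= `|q| ^+ 2 -> `|x| <= `|q|.
  by move=> h; rewrite -(@ler_pXn2r _ 2) ?nnegrE// real_normK ?num_real.
have := (sqr_ge0 (qre q), sqr_ge0 (qi q), sqr_ge0 (qj q), sqr_ge0 (qk q)).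
by move=> [[[h0 h1] h2] h3]; split; apply: le; rewrite quat_norm_sqr; lra.
Qed.

Lemma quat_norm_le_coord (a b c d : R) :
  `|Quat a b c d| <= `|a| + `|b| + `|c| + `|d|.
Proof.
rewrite -(@ler_pXn2r _ 2) ?nnegrE ?addr_ge0// quat_norm_sqr /=.
rewrite -(real_normK (num_real a)) -(real_normK (num_real b)).
rewrite -(real_normK (num_real c)) -(real_normK (num_real d)).
move: (normr_ge0 a) (normr_ge0 b) (normr_ge0 c) (normr_ge0 d).
move: `|a| `|b| `|c| `|d| => x y z t x0 y0 z0 t0.
rewrite -subr_ge0.
rewrite (_ : _ - _ = 2 * (x * y + x * z + x * t + y * z + y * t + z * t)).
  by rewrite mulr_ge0// !addr_ge0// mulr_ge0.
by ring.
Qed.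

Lemma sum_Quat (a b c d : nat -> R) N :
  \sum_(0 <= n < N) Quat (a n) (b n) (c n) (d n) =
  Quat (\sum_(0 <= n < N) a n) (\sum_(0 <= n < N) b n)
       (\sum_(0 <= n < N) c n) (\sum_(0 <= n < N) d n).
Proof.
elim: N => [|N IH]; first by rewrite !big_geq.
by rewrite !big_nat_recr//= IH; apply: quatP.
Qed.

Lemma cvg_Quat (u v s t : nat -> R) (a b c d : R) :
  u n @[n --> \oo] --> a -> v n @[n --> \oo] --> b ->
  s n @[n --> \oo] --> c -> t n @[n --> \oo] --> d ->
  (fun n => Quat (u n) (v n) (s n) (t n)) @ \oo --> Quat a b c d.
Proof.
move=> ua vb sc td; apply/cvgrPdist_le => /= e e0.
have e4 : 0 < e / 4 by rewrite divr_gt0.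
move/cvgrPdist_le : ua => /(_ _ e4) ua.
move/cvgrPdist_le : vb => /(_ _ e4) vb.
move/cvgrPdist_le : sc => /(_ _ e4) sc.
move/cvgrPdist_le : td => /(_ _ e4) td.
near=> n.
apply: (le_trans (quat_norm_le_coord (a - u n) (b - v n) (c - s n) (d - t n))).
have h1 : `|a - u n| <= e / 4 by near: n; exact: ua.
have h2 : `|b - v n| <= e / 4 by near: n; exact: vb.
have h3 : `|c - s n| <= e / 4 by near: n; exact: sc.
have h4 : `|d - t n| <= e / 4 by near: n; exact: td.
by lra.
Unshelve. all: by end_near. Qed.

End quaternion_theory.

(** * Quaternionic square integrable functions by coordinates *)

Section coordinates.
Context {R : realType}.
Variable alpha : R.
Local Notation mu := (@lebesgue_measure R).
Local Notation w := (laguerre_weight alpha).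
Local Notation H := (quaternion R).
Local Notation ipw := (ip mu Rplus w).
Local Notation sqintw := (sqint mu Rplus w).
Implicit Types phi psi : R -> H.

Definition sqnorm phi : R :=
  ipw (fun x => qre (phi x)) (fun x => qre (phi x)) +
  ipw (fun x => qi (phi x)) (fun x => qi (phi x)) +
  ipw (fun x => qj (phi x)) (fun x => qj (phi x)) +
  ipw (fun x => qk (phi x)) (fun x => qk (phi x)).

Lemma measurable_norm_sqr phi : qmeasurable Rplus phi ->
  measurable_fun (Rplus : set (measurableTypeR R))
    (fun x => `|phi x| ^+ 2 * w x).
Proof.
move=> [m0 m1 m2 m3]; apply: measurable_funM; last exact: measurable_weight.
rewrite (_ : (fun x => _) = (fun x => qre (phi x) ^+ 2 + qi (phi x) ^+ 2 +
  qj (phi x) ^+ 2 + qk (phi x) ^+ 2)); last first.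
  by apply/funext => x; rewrite quat_norm_sqr.
by do 3?[apply: measurable_funD]; apply: measurable_funX.
Qed.

Lemma integrable_norm_sqr phi : L2 alpha phi ->
  mu.-integrable Rplus (fun x => (`|phi x| ^+ 2 * w x)%:E).
Proof.
move=> [mphi fin]; apply/integrableP; split.
  by apply/measurable_EFinP; exact: measurable_norm_sqr.
under eq_integral => x /[!inE] Dx.
  rewrite gee0_abs; last by rewrite lee_fin mulr_ge0 ?sqr_ge0 ?weight_ge0.
  over.
exact: fin.
Qed.

Lemma L2_coord phi : L2 alpha phi ->
  [/\ sqintw (fun x => qre (phi x)), sqintw (fun x => qi (phi x)),
      sqintw (fun x => qj (phi x)) & sqintw (fun x => qk (phi x))].
Proof.
move=> L2phi; have int := integrable_norm_sqr L2phi.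
case: L2phi => -[m0 m1 m2 m3] _.
have D := @measurable_Rplus R.
have coord (c : H -> R) : (forall q, `|c q| <= `|q|) ->
    measurable_fun (Rplus : set (measurableTypeR R)) (fun x => c (phi x)) ->
    sqintw (fun x => c (phi x)).
  move=> cq mc; split => //.
  apply: (le_integrable D _ _ int).
    apply/measurable_EFinP.
    apply: measurable_funM; last exact: measurable_weight.
    exact: measurable_funX.
  move=> x Dx; have wx := weight_ge0 alpha Dx.
  have c2 : c (phi x) ^+ 2 <= `|phi x| ^+ 2.
    by rewrite -[leLHS]real_normK ?num_real// ler_pXn2r ?nnegrE.
  rewrite /= lee_fin !ger0_norm; [|exact: mulr_ge0 (sqr_ge0 _) wx..].
  exact: ler_wpM2r.
by split; apply: coord => // q; have [] := quat_coord_le_norm q.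
Qed.

Lemma sqnormE phi : L2 alpha phi ->
  (\int[mu]_(x in Rplus) (`|phi x| ^+ 2 * w x)%:E = (sqnorm phi)%:E)%E.
Proof.
move=> L2phi; have D := @measurable_Rplus R.
have [[_ i0] [_ i1] [_ i2] [_ i3]] := L2_coord L2phi.
have fin f : mu.-integrable Rplus (fun x => (f x ^+ 2 * w x)%:E) ->
    (ipw f f)%:E = (\int[mu]_(x in Rplus) (f x ^+ 2 * w x)%:E)%E.
  by move=> intf; rewrite /ip /Rintegral fineK// integrable_fin_num.
rewrite /sqnorm !EFinD !fin// -(integralD D i0 i1).
rewrite -(integralD D (integrableD D i0 i1) i2).
rewrite -(integralD D (integrableD D (integrableD D i0 i1) i2) i3).
apply: eq_integral => x _ /=.
by rewrite -!EFinD; congr EFin; rewrite quat_norm_sqr; ring.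
Qed.

Lemma L2norm_sqnorm phi : L2 alpha phi ->
  L2norm alpha phi = Num.sqrt (sqnorm phi).
Proof.
move=> L2phi; congr Num.sqrt.
have := sqnormE L2phi => /(congr1 fine) /= <-.
by apply: eq_Rintegral => x _; rewrite quat_norm_sqr /=; ring.
Qed.

Lemma coord_L2 phi :
  sqintw (fun x => qre (phi x)) -> sqintw (fun x => qi (phi x)) ->
  sqintw (fun x => qj (phi x)) -> sqintw (fun x => qk (phi x)) -> L2 alpha phi.
Proof.
move=> [m0 i0] [m1 i1] [m2 i2] [m3 i3]; split; first by split.
have D := @measurable_Rplus R.
have int := integrableD D (integrableD D (integrableD D i0 i1) i2) i3.
have /integrableP[_] : mu.-integrable Rplus (fun x => (`|phi x| ^+ 2 * w x)%:E).
  apply: (eq_integrable D _ _ _ int) => x _ /=.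
  by rewrite -!EFinD; congr EFin; rewrite quat_norm_sqr; ring.
apply: le_lt_trans; apply: ge0_le_integral => //.
- move=> x Dx; have wx := weight_ge0 alpha Dx.
  by rewrite lee_fin mulr_ge0// sqr_ge0.
- apply/measurable_EFinP; apply: measurable_norm_sqr; by split.
- apply: measurableT_comp => //.
  apply/measurable_EFinP; apply: measurable_norm_sqr; by split.
by move=> x _; rewrite lee_abs.
Qed.

Lemma L2B phi psi : L2 alpha phi -> L2 alpha psi -> L2 alpha (phi - psi).
Proof.
move=> /L2_coord[p0 p1 p2 p3] /L2_coord[q0 q1 q2 q3].
have sub f g : sqintw f -> sqintw g -> sqintw (fun x => f x - g x).
  move=> sf sg.
  have := sqintB (@measurable_Rplus R) (@weight_ge0 R alpha)
     (@measurable_weight R alpha) 1 sf sg.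
  by under [X in sqint _ _ _ X -> _]eq_fun do rewrite mul1r.
by apply: coord_L2; exact: sub.
Qed.

End coordinates.

(** * The Laguerre transform *)

Lemma Rintegral_comb4 d (T : measurableType d) (R : realType)
    (mu : {measure set T -> \bar R}) (D : set T) (mD : measurable D)
    (f0 f1 f2 f3 : T -> R) (c1 c2 c3 : R) :
  mu.-integrable D (EFin \o f0) -> mu.-integrable D (EFin \o f1) ->
  mu.-integrable D (EFin \o f2) -> mu.-integrable D (EFin \o f3) ->
  let f := fun x => f0 x + c1 * f1 x + c2 * f2 x + c3 * f3 x in
  mu.-integrable D (EFin \o f) /\
  \int[mu]_(x in D) f x = \int[mu]_(x in D) f0 x + c1 * \int[mu]_(x in D) f1 x +
    c2 * \int[mu]_(x in D) f2 x + c3 * \int[mu]_(x in D) f3 x.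
Proof.
move=> i0 i1 i2 i3 f.
have j1 := integrableZl mD c1 i1.
have j2 := integrableZl mD c2 i2.
have j3 := integrableZl mD c3 i3.
have k1 := integrableD mD i0 j1.
have k2 := integrableD mD k1 j2.
have k3 := integrableD mD k2 j3.
split; first exact: k3.
rewrite /f (RintegralD mD k2 j3) (RintegralD mD k1 j2) (RintegralD mD i0 j1).
by rewrite !RintegralZl.
Qed.

Section laguerre_operator.
Context {R : realType}.
Variables (alpha : R) (theta : quaternion R).
Hypothesis alpha0 : 0 <= alpha.
Hypothesis theta1 : `|theta| < 1.
Local Notation mu := (@lebesgue_measure R).
Local Notation w := (laguerre_weight alpha).
Local Notation H := (quaternion R).
Local Notation e := (lagfun alpha).
Local Notation ipw := (ip mu Rplus w).
Local Notation sqintw := (sqint mu Rplus w).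
Local Notation L := (laguerre_transform alpha theta).

Let D := @measurable_Rplus R.
Let w0 := @weight_ge0 R alpha.
Let mw := @measurable_weight R alpha.

Let r01 : 0 <= `|theta| < 1. Proof. by rewrite normr_ge0. Qed.

Let r2 : 0 <= `|theta| ^+ 2 < 1.
Proof. by rewrite exprn_ge0//= expr_lt1. Qed.

Lemma coord_theta n :
  [/\ `|qre (theta ^+ n)| <= `|theta| ^+ n, `|qi (theta ^+ n)| <= `|theta| ^+ n,
      `|qj (theta ^+ n)| <= `|theta| ^+ n &
      `|qk (theta ^+ n)| <= `|theta| ^+ n].
Proof. by rewrite -quat_normX; exact: quat_coord_le_norm. Qed.

(* The coordinates of the powers of theta: the quaternionic kernel is made of
   the four real Mehler kernels with these coefficients. *)
Let t0 n := qre (theta ^+ n).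
Let t1 n := qi (theta ^+ n).
Let t2 n := qj (theta ^+ n).
Let t3 n := qk (theta ^+ n).
Let b0 n : `|t0 n| <= `|theta| ^+ n. Proof. by have [] := coord_theta n. Qed.
Let b1 n : `|t1 n| <= `|theta| ^+ n. Proof. by have [] := coord_theta n. Qed.
Let b2 n : `|t2 n| <= `|theta| ^+ n. Proof. by have [] := coord_theta n. Qed.
Let b3 n : `|t3 n| <= `|theta| ^+ n. Proof. by have [] := coord_theta n. Qed.

Local Notation ker := (mehler_kernel e).

Lemma laguerre_termE x y n : 0 < x -> 0 < y ->
  laguerre_term alpha theta x y n = (e n x * e n y) *: theta ^+ n.
Proof.
move=> x0 y0; rewrite /laguerre_term !laguerreE// /lagfun; congr (_ *: _).
have N0 := lagnorm_gt0 alpha0 n.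
have f0 : n`!%:R != 0 :> R by rewrite pnatr_eq0 -lt0n fact_gt0.
rewrite [RHS]mulf_div -expr2 sqr_sqrtr ?(ltW N0)//.
have G0 : Gamma (alpha + n%:R + 1) != 0.
  by rewrite gt_eqF// Gamma_gt0// addr_ge0.
move: (rodpoly n alpha).[x] (rodpoly n alpha).[y] => a b.
move: (Gamma _) (n`!%:R) G0 f0 => G f G0 f0.
by field; rewrite G0 f0.
Qed.

Lemma cvg_laguerre_series x y : 0 < x -> 0 < y ->
  series (laguerre_term alpha theta x y) @ \oo -->
  Quat (ker t0 x y) (ker t1 x y) (ker t2 x y) (ker t3 x y).
Proof.
move=> x0 y0.
have Dx : Rplus x by rewrite in_Rplus.
have Dy : Rplus y by rewrite in_Rplus.
have cv := lagfun_cvg alpha0.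
rewrite (_ : series _ = (fun N =>
   Quat (series (fun n => t0 n * e n x * e n y) N)
        (series (fun n => t1 n * e n x * e n y) N)
        (series (fun n => t2 n * e n x * e n y) N)
        (series (fun n => t3 n * e n x * e n y) N))).
  by apply: cvg_Quat; apply: (is_cvg_kernel cv r01).
apply/funext => N; rewrite /series /= -sum_Quat; apply: eq_bigr => n _.
rewrite laguerre_termE//; apply: quatP => /=; rewrite -[RHS]mulrA mulrC//.
Qed.

Lemma laguerre_KE x y : 0 < x -> 0 < y ->
  laguerre_K alpha theta x y =
  w x *: Quat (ker t0 x y) (ker t1 x y) (ker t2 x y) (ker t3 x y).
Proof.
move=> x0 y0; rewrite /laguerre_K /laguerre_R; congr (_ *: _).
by apply/cvg_lim; [exact: norm_hausdorff|exact: cvg_laguerre_series].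
Qed.


Let kint (t : nat -> R) (g : R -> R) y : R :=
  \int[mu]_(x in Rplus) (w x * (ker t x y * g x)).

Let kintP (t : nat -> R) g y : (forall n, `|t n| <= `|theta| ^+ n) ->
  sqintw g -> 0 < y ->
  mu.-integrable Rplus (fun x => (w x * (ker t x y * g x))%:E) /\
  (\sum_(0 <= n < N) t n * ipw (e n) g * e n y) @[N --> \oo] --> kint t g y.
Proof.
move=> tb sg y0; have Dy : Rplus y by rewrite in_Rplus.
exact: (kernel_integral D w0 mw (lagfun_sqint alpha0) (lagfun_orth alpha0)
  (lagfun_cvg alpha0) r01 tb sg Dy).
Qed.

(** The signs are those of the quaternion product, written as coefficients to
    match [Rintegral_comb4]. *)
Lemma laguerre_transformE phi y : L2 alpha phi -> 0 < y ->
  let f0 := fun x => qre (phi x) in let f1 := fun x => qi (phi x) in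
  let f2 := fun x => qj (phi x) in let f3 := fun x => qk (phi x) in
  qintegrable Rplus (fun x => laguerre_K alpha theta x y * phi x) /\
  L phi y = Quat
    (kint t0 f0 y + -1 * kint t1 f1 y + -1 * kint t2 f2 y + -1 * kint t3 f3 y)
    (kint t0 f1 y + 1 * kint t1 f0 y + 1 * kint t2 f3 y + -1 * kint t3 f2 y)
    (kint t0 f2 y + -1 * kint t1 f3 y + 1 * kint t2 f0 y + 1 * kint t3 f1 y)
    (kint t0 f3 y + 1 * kint t1 f2 y + -1 * kint t2 f1 y + 1 * kint t3 f0 y).
Proof.
move=> L2phi y0 f0 f1 f2 f3.
have [s0 s1 s2 s3] := L2_coord L2phi.
have int t g (tb : forall n, `|t n| <= `|theta| ^+ n) (sg : sqintw g) :=
  (kintP tb sg y0).1.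
have [i0 v0] := Rintegral_comb4 D (-1) (-1) (-1)
  (int _ _ b0 s0) (int _ _ b1 s1) (int _ _ b2 s2) (int _ _ b3 s3).
have [i1 v1] := Rintegral_comb4 D 1 1 (-1)
  (int _ _ b0 s1) (int _ _ b1 s0) (int _ _ b2 s3) (int _ _ b3 s2).
have [i2 v2] := Rintegral_comb4 D (-1) 1 1
  (int _ _ b0 s2) (int _ _ b1 s3) (int _ _ b2 s0) (int _ _ b3 s1).
have [i3 v3] := Rintegral_comb4 D 1 (-1) 1
  (int _ _ b0 s3) (int _ _ b1 s2) (int _ _ b2 s1) (int _ _ b3 s0).
have KE x : x \in Rplus -> laguerre_K alpha theta x y =
    w x *: Quat (ker t0 x y) (ker t1 x y) (ker t2 x y) (ker t3 x y).
  by rewrite inE in_Rplus => x0; exact: laguerre_KE.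
split.
  split; [apply: (eq_integrable D _ _ _ i0)|apply: (eq_integrable D _ _ _ i1)|
    apply: (eq_integrable D _ _ _ i2)|apply: (eq_integrable D _ _ _ i3)];
  by move=> x Dx; congr EFin; rewrite KE//=; ring.
rewrite /laguerre_transform /qintegral /kint /f0 /f1 /f2 /f3 -v0 -v1 -v2 -v3.
by congr Quat; apply: eq_Rintegral => x Dx; rewrite KE//=; ring.
Qed.

Lemma measurable_transform phi : L2 alpha phi -> qmeasurable Rplus (L phi).
Proof.
move=> L2phi; have [s0 s1 s2 s3] := L2_coord L2phi.
have mkint t g : (forall n, `|t n| <= `|theta| ^+ n) -> sqintw g ->
    measurable_fun (Rplus : set (measurableTypeR R)) (kint t g).
  move=> tb sg.
  apply: (@measurable_fun_cvg _ _ _ _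
    (fun N y => \sum_(0 <= n < N) t n * ipw (e n) g * e n y)).
    move=> N; apply: measurable_sum => n; apply: measurable_funM => //.
    by have [] := lagfun_sqint alpha0 n.
  by move=> y; rewrite in_Rplus => y0; exact: (kintP tb sg y0).2.
have comb (f0 f1 f2 f3 : R -> R) c1 c2 c3 :
    measurable_fun (Rplus : set (measurableTypeR R)) f0 ->
    measurable_fun (Rplus : set (measurableTypeR R)) f1 ->
    measurable_fun (Rplus : set (measurableTypeR R)) f2 ->
    measurable_fun (Rplus : set (measurableTypeR R)) f3 ->
    measurable_fun (Rplus : set (measurableTypeR R))
      (fun y => f0 y + c1 * f1 y + c2 * f2 y + c3 * f3 y).
  move=> m0 m1 m2 m3.
  by do 3!(apply: measurable_funD; last exact: measurable_funM).
have transformE := fun y (y0 : 0 < y) => (laguerre_transformE L2phi y0).2.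
split.
- apply: (eq_measurable_fun _ _ (comb _ _ _ _ (-1) (-1) (-1)
    (mkint _ _ b0 s0) (mkint _ _ b1 s1) (mkint _ _ b2 s2) (mkint _ _ b3 s3))).
  by move=> y; rewrite inE in_Rplus => y0; rewrite transformE.
- apply: (eq_measurable_fun _ _ (comb _ _ _ _ 1 1 (-1)
    (mkint _ _ b0 s1) (mkint _ _ b1 s0) (mkint _ _ b2 s3) (mkint _ _ b3 s2))).
  by move=> y; rewrite inE in_Rplus => y0; rewrite transformE.
- apply: (eq_measurable_fun _ _ (comb _ _ _ _ (-1) 1 1
    (mkint _ _ b0 s2) (mkint _ _ b1 s3) (mkint _ _ b2 s0) (mkint _ _ b3 s1))).
  by move=> y; rewrite inE in_Rplus => y0; rewrite transformE.
- apply: (eq_measurable_fun _ _ (comb _ _ _ _ 1 (-1) 1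
    (mkint _ _ b0 s3) (mkint _ _ b1 s2) (mkint _ _ b2 s1) (mkint _ _ b3 s0))).
  by move=> y; rewrite inE in_Rplus => y0; rewrite transformE.
Qed.

Let coef phi n : H := Quat (ipw (e n) (fun x => qre (phi x)))
  (ipw (e n) (fun x => qi (phi x))) (ipw (e n) (fun x => qj (phi x)))
  (ipw (e n) (fun x => qk (phi x))).

(** The transform is diagonal: it multiplies the [n]-th coefficient of [phi] by
    [theta ^+ n] on the left. *)
Lemma cvg_transform phi y : L2 alpha phi -> 0 < y ->
  (\sum_(0 <= n < N) e n y *: (theta ^+ n * coef phi n)) @[N --> \oo] -->
    L phi y.
Proof.
move=> L2phi y0; have [s0 s1 s2 s3] := L2_coord L2phi.
rewrite (laguerre_transformE L2phi y0).2.
pose S (t a : nat -> R) N := \sum_(0 <= n < N) t n * a n * e n y.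
pose a0 n := ipw (e n) (fun x => qre (phi x)).
pose a1 n := ipw (e n) (fun x => qi (phi x)).
pose a2 n := ipw (e n) (fun x => qj (phi x)).
pose a3 n := ipw (e n) (fun x => qk (phi x)).
have termE n : e n y *: (theta ^+ n * coef phi n) = Quat
    (e n y * (t0 n * a0 n - t1 n * a1 n - t2 n * a2 n - t3 n * a3 n))
    (e n y * (t0 n * a1 n + t1 n * a0 n + t2 n * a3 n - t3 n * a2 n))
    (e n y * (t0 n * a2 n - t1 n * a3 n + t2 n * a0 n + t3 n * a1 n))
    (e n y * (t0 n * a3 n + t1 n * a2 n - t2 n * a1 n + t3 n * a0 n)).
  by [].
rewrite (_ : (fun N => _) = (fun N => Quat
    (S t0 a0 N + -1 * S t1 a1 N + -1 * S t2 a2 N + -1 * S t3 a3 N)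
    (S t0 a1 N + 1 * S t1 a0 N + 1 * S t2 a3 N + -1 * S t3 a2 N)
    (S t0 a2 N + -1 * S t1 a3 N + 1 * S t2 a0 N + 1 * S t3 a1 N)
    (S t0 a3 N + 1 * S t1 a2 N + -1 * S t2 a1 N + 1 * S t3 a0 N))); last first.
  apply/funext => N; under eq_bigr do rewrite termE.
  rewrite sum_Quat /S; move: (t0) (t1) (t2) (t3) (a0) (a1) (a2) (a3) (e^~ y).
  move=> u0 u1 u2 u3 c0 c1 c2 c3 ey.
  elim: N => [|N IH]; first by rewrite !big_geq//; apply: quatP => /=; ring.
  rewrite !big_nat_recr//=; case: IH => h0 h1 h2 h3.
  by rewrite h0 h1 h2 h3; apply: quatP => /=; ring.
have cv t g (tb : forall n, `|t n| <= `|theta| ^+ n) (sg : sqintw g) :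
  S t (fun n => ipw (e n) g) N @[N --> \oo] --> kint t g y :=
  (kintP tb sg y0).2.
have comb u0 u1 u2 u3 (l0 l1 l2 l3 : R) (c1 c2 c3 : R) :
  u0 N @[N --> \oo] --> l0 -> u1 N @[N --> \oo] --> l1 ->
  u2 N @[N --> \oo] --> l2 -> u3 N @[N --> \oo] --> l3 ->
  u0 N + c1 * u1 N + c2 * u2 N + c3 * u3 N @[N --> \oo] -->
    l0 + c1 * l1 + c2 * l2 + c3 * l3.
  move=> h0 h1 h2 h3.
  by do 3!(apply: cvgD; last by apply: cvgM => //; exact: cvg_cst).
by apply: cvg_Quat; apply: comb; apply: cv.
Qed.

Lemma sum_coef_le phi N : L2 alpha phi ->
  \sum_(0 <= n < N) `|coef phi n| ^+ 2 <= sqnorm alpha phi.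
Proof.
move=> L2phi; have [s0 s1 s2 s3] := L2_coord L2phi.
have bes g (sg : sqintw g) := Bessel_inequality D w0 mw
  (lagfun_sqint alpha0) (lagfun_orth alpha0) N sg.
under eq_bigr do rewrite quat_norm_sqr.
by rewrite !big_split/= /sqnorm !lerD//; exact: bes.
Qed.

(** Cauchy-Schwarz for the expansion of [cvg_transform], with the coefficients
    of [phi] on one side and the [theta ^+ n] and [e n y] on the other. *)
Lemma transform_sqr_le phi y : L2 alpha phi -> 0 < y ->
  `|L phi y| ^+ 2 <= sqnorm alpha phi * mehler_diag e (`|theta| ^+ 2) y.
Proof.
move=> L2phi y0; have Dy : Rplus y by rewrite in_Rplus.
set B := sqnorm _ _ * _.
have diag0 N := diag_ge (lagfun_cvg alpha0) N r2 Dy.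
have sumB N : `|\sum_(0 <= n < N) e n y *: (theta ^+ n * coef phi n)| ^+ 2 <= B.
  apply: (@le_trans _ _ ((\sum_(0 <= n < N)
      `|coef phi n| * (`|theta| ^+ n * `|e n y|)) ^+ 2)).
    rewrite ler_pXn2r ?nnegrE//; last first.
      by apply: sumr_ge0 => n _; rewrite !mulr_ge0// exprn_ge0.
    apply: (le_trans (ler_norm_sum _ _ _)); apply: ler_sum => n _.
    by rewrite normrZ quat_normM quat_normX mulrC mulrAC mulrC mulrA.
  apply: (le_trans (CauchySchwarz_sum _ _ _)); apply: ler_pM.
  - by apply: sumr_ge0 => n _; exact: sqr_ge0.
  - by apply: sumr_ge0 => n _; exact: sqr_ge0.
  - exact: sum_coef_le.
  apply: le_trans (diag0 N); apply: ler_sum => n _.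
  by rewrite exprMn real_normK ?num_real// -!exprM mulnC.
have B0 : 0 <= B by apply: le_trans (sumB 0%N); exact: sqr_ge0.
have cv := cvg_transform L2phi y0.
pose s : R^nat := fun N =>
  `|\sum_(0 <= n < N) e n y *: (theta ^+ n * coef phi n)|.
have cvs : s @ \oo --> (`|L phi y| : R) by exact: cvg_norm cv.
rewrite -[leRHS]sqr_sqrtr// ler_pXn2r ?nnegrE//.
rewrite -(cvg_lim (@Rhausdorff R) cvs)//.
apply: limr_le; first exact: cvgP cvs.
apply: nearW => N; rewrite -(@ler_pXn2r _ 2) ?nnegrE ?sqrtr_ge0 /s//.
by rewrite (sqr_sqrtr B0); exact: sumB.
Qed.

Lemma transform_L2 phi : L2 alpha phi ->
  L2 alpha (L phi) /\
  sqnorm alpha (L phi) <= (1 - `|theta| ^+ 2)^-1 * sqnorm alpha phi.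
Proof.
move=> L2phi.
have mL := measurable_transform L2phi.
have le : (\int[mu]_(x in Rplus) (`|L phi x| ^+ 2 * w x)%:E <=
    ((1 - `|theta| ^+ 2)^-1 * sqnorm alpha phi)%:E)%E.
  have intd := integrable_diag D w0 mw
    (lagfun_sqint alpha0) (lagfun_orth alpha0) (lagfun_cvg alpha0) r2.
  have intE := integral_diag D w0 mw
    (lagfun_sqint alpha0) (lagfun_orth alpha0) (lagfun_cvg alpha0) r2.
  rewrite mulrC EFinM -intE -integralZl//.
  apply: ge0_le_integral => //.
  - by move=> x Dx; rewrite lee_fin mulr_ge0 ?sqr_ge0 ?weight_ge0.
  - by apply/measurable_EFinP; apply: measurable_norm_sqr.
  - by have /integrableP[] := integrableZl D (sqnorm alpha phi) intd.
  move=> x /[dup] Dx; rewrite in_Rplus => x0.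
  rewrite -EFinM lee_fin (mulrA (sqnorm _ _)).
  by apply: ler_wpM2r; [exact: w0|exact: transform_sqr_le].
have L2L : L2 alpha (L phi) by split => //; apply: le_lt_trans le (ltry _).
by split => //; rewrite -lee_fin -sqnormE.
Qed.


Lemma transformB phi psi y : L2 alpha phi -> L2 alpha psi -> 0 < y ->
  L (phi - psi) y = L phi y - L psi y.
Proof.
move=> L2phi L2psi y0.
have [[a0 a1 a2 a3] _] := laguerre_transformE L2phi y0.
have [[c0 c1 c2 c3] _] := laguerre_transformE L2psi y0.
have E x : laguerre_K alpha theta x y * (phi - psi) x =
  laguerre_K alpha theta x y * phi x - laguerre_K alpha theta x y * psi x.
  exact: mulrBr.
rewrite /laguerre_transform /qintegral; apply: quatP;
  rewrite [RHS]/= -RintegralB//; apply: eq_Rintegral => x _; by rewrite E.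
Qed.

Lemma L2norm_transform_le phi : L2 alpha phi ->
  L2norm alpha (L phi) <=
    Num.sqrt (1 - `|theta| ^+ 2)^-1 * L2norm alpha phi.
Proof.
move=> L2phi; have [L2L le] := transform_L2 L2phi.
have /andP[_ h2] := r2.
rewrite !L2norm_sqnorm// -sqrtrM; last by rewrite invr_ge0 subr_ge0 ltW.
by rewrite ler_wsqrtr.
Qed.

(** [transform_sqr_le] for the difference, whose norm is zero; the transforms
    agree at every point, not only almost everywhere. *)
Lemma transform_ae_eq phi psi : L2 alpha phi -> L2 alpha psi ->
  phi = psi %[ae mu in Rplus] -> forall y, 0 < y -> L phi y = L psi y.
Proof.
move=> L2phi L2psi pp y y0; have L2B := L2B L2phi L2psi.
apply/eqP; rewrite -subr_eq0 -transformB//.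
have s0 : sqnorm alpha (phi - psi) = 0.
  apply: EFin_inj; rewrite -sqnormE// -[RHS](integral0 mu Rplus).
  apply: ae_eq_integral => //.
    by have /integrableP[] := integrable_norm_sqr L2B.
  apply: (@filterS _ _ (ae_filter_ringOfSetsType mu) _ _ _ pp) => x xE Dx.
  have E := xE Dx.
  have -> : (phi - psi) x = 0 by rewrite -[LHS]/(phi x - psi x) E subrr.
  by rewrite normr0 expr0n mul0r.
have := transform_sqr_le L2B y0; rewrite s0 mul0r => h.
rewrite -normr_le0 -[X in _ <= X]sqrtr0 -(ger0_norm (normr_ge0 _)).
by rewrite -sqrtr_sqr ler_wsqrtr.
Qed.

End laguerre_operator.

(* The first two conjuncts say that the series defining the kernel and the
   integral defining the transform make sense. *)
Theorem proposition2p4 (R : realType) (alpha : R) (theta : quaternion R)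
    (halpha : 0 < alpha) (htheta : `|theta| < 1) :
  [/\ forall x y : R, 0 < x -> 0 < y ->
        cvgn (series (laguerre_term alpha theta x y)),
      forall phi : R -> quaternion R, L2 alpha phi -> forall y : R, 0 < y ->
        qintegrable Rplus (fun x => laguerre_K alpha theta x y * phi x),
      maps_L2 alpha (laguerre_transform alpha theta),
      L2_continuous alpha (laguerre_transform alpha theta) &
      exists k : R, [/\ 0 <= k, k <= (1 - `|theta| ^+ 2) `^ (- (1 / 2)) &
        forall phi : R -> quaternion R, L2 alpha phi ->
          L2norm alpha (laguerre_transform alpha theta phi)
            <= k * L2norm alpha phi]].
Proof.
have a0 := ltW halpha.
set k := Num.sqrt (1 - `|theta| ^+ 2)^-1.
have t2 : 0 < 1 - `|theta| ^+ 2 by rewrite subr_gt0 expr_lt1.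
have k0 : 0 < k by rewrite sqrtr_gt0 invr_gt0.
split.
- by move=> x y x0 y0; apply: cvgP; exact: (cvg_laguerre_series a0 htheta).
- by move=> phi L2phi y y0; have [] := laguerre_transformE a0 htheta L2phi y0.
- split=> [phi L2phi|phi psi L2phi L2psi pp].
    by have [] := transform_L2 a0 htheta L2phi.
  apply: aeW => y; rewrite in_Rplus => y0.
  exact: (transform_ae_eq a0 htheta L2phi L2psi pp y0).
- move=> phi L2phi eps eps0; exists (eps / k); first exact: divr_gt0.
  move=> psi L2psi; rewrite ltr_pdivlMr// mulrC => dk.
  apply: le_lt_trans dk.
  have -> : L2norm alpha (laguerre_transform alpha theta psi -
      laguerre_transform alpha theta phi) =
      L2norm alpha (laguerre_transform alpha theta (psi - phi)).
    congr Num.sqrt; apply: eq_Rintegral => y; rewrite inE in_Rplus => y0.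
    by rewrite (transformB a0 htheta L2psi L2phi y0).
  by apply: L2norm_transform_le => //; exact: L2B.
exists k; split => [||phi L2phi]; first exact: ltW.
  by rewrite powRN div1r powR12_sqrt ?(ltW t2)// /k sqrtrV ?(ltW t2).
exact: L2norm_transform_le.
Qed.
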